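(* Let $(W,S)$ be a Coxeter system of finite rank. For each $I\subseteq S$ let $\mathcal{C}_I$ denote either the set $\mathbf{I}_{W_I,\mathrm{id}}=\{z\in W_I: z^2=e\}$ (the same choice for all $I$), or the set $T_{W_I}=\{w^{-1}sw: w\in W_I,\ s\in I\}$ of reflections of $W_I$ (the same choice for all $I$), and put $\mathcal{C}=\mathcal{C}_S$. Then, in both cases, the length-generating function $\mathcal{C}(q)$ (that is, $\mathbf{I}_{W,\mathrm{id}}(q)$, respectively $T_W(q)$) is rational and satisfies the following recurrence relations. If $W$ is infinite, then $$\sum_{I\subseteq S}(-1)^{|I|}\frac{\mathcal{C}_I(q)}{W_I(q^2)}=0,$$ or, equivalently, $$\frac{\mathcal{C}(q)}{W(q^2)}=\sum_{I\subsetneq S}(-1)^{|S\setminus I|-1}\frac{\mathcal{C}_I(q)}{W_I(q^2)}.$$ If $W$ is finite with longest element $w_0$ and $N=\ell(w_0)$, then $$\frac{\mathcal{C}(q)+(-1)^{|S|-1}q^{2N}\mathcal{C}(-q^{-1})}{W(q^2)}=\sum_{I\subsetneq S}(-1)^{|S\setminus I|-1}\frac{\mathcal{C}_I(q)}{W_I(q^2)}.$$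
   Context: $(W,S)$ is a Coxeter system with $S$ finite, identity $e$ and length function $\ell$. For $A\subseteq W$, $A(q)=\sum_{w\in A}q^{\ell(w)}$ (a formal power series; rational means it is the expansion of a quotient of polynomials). For $I\subseteq S$, $W_I=\langle I\rangle$ is the parabolic subgroup generated by $I$; $(W_I,I)$ is a Coxeter system whose length function is the restriction of $\ell$. Note that the identity element is counted among the involutions in $\mathbf{I}_{W,\mathrm{id}}$. *)

(* Defs.v *)
From HB Require Import structures.
From mathcomp Require Import all_boot all_order all_algebra finmap.
From mathcomp Require Import boolp classical_sets functions cardinality fsbigop.

Set Implicit Arguments.
Unset Strict Implicit.
Unset Printing Implicit Defensive.

Import GRing.Theory.

Local Open Scope classical_set_scope.
Local Open Scope ring_scope.

Record fps (R : Type) := FPS { fpscoef : nat -> R }.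

HB.instance Definition _ (R : Type) := gen_eqMixin (fps R).
HB.instance Definition _ (R : Type) := gen_choiceMixin (fps R).

Lemma fpsP (R : Type) (f g : fps R) : fpscoef f =1 fpscoef g -> f = g.
Proof. by case: f g => [f] [g] /= /funext ->. Qed.

Section FpsRing.
Variable R : comUnitRingType.
Implicit Types f g h : fps R.

Definition fps_add f g := FPS (fun n => fpscoef f n + fpscoef g n).
Definition fps_opp f := FPS (fun n => - fpscoef f n).
Definition fps_of_poly (p : {poly R}) : fps R := FPS (fun n => p`_n).
Definition fps_mul f g :=
  FPS (fun n => \sum_(i < n.+1) fpscoef f i * fpscoef g (n - i)).

Fact fps_addA : associative fps_add.
Proof. by move=> f g h; apply: fpsP => n /=; rewrite addrA. Qed.
Fact fps_addC : commutative fps_add.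
Proof. by move=> f g; apply: fpsP => n /=; rewrite addrC. Qed.
Fact fps_add0 : left_id (fps_of_poly 0) fps_add.
Proof. by move=> f; apply: fpsP => n /=; rewrite coef0 add0r. Qed.
Fact fps_addN : left_inverse (fps_of_poly 0) fps_opp fps_add.
Proof. by move=> f; apply: fpsP => n /=; rewrite coef0 addNr. Qed.

HB.instance Definition _ :=
  GRing.isZmodule.Build (fps R) fps_addA fps_addC fps_add0 fps_addN.

Let trunc N f : {poly R} := \poly_(i < N) fpscoef f i.

Let truncE N f i : (i < N)%N -> (trunc N f)`_i = fpscoef f i.
Proof. by move=> iN; rewrite coef_poly iN. Qed.

Let coef_mul_trunc N f g (p q : {poly R}) n : (n < N)%N ->
    (forall i, (i < N)%N -> p`_i = fpscoef f i) ->
    (forall i, (i < N)%N -> q`_i = fpscoef g i) ->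
  (p * q)`_n = fpscoef (fps_mul f g) n.
Proof.
move=> nN pf qg; rewrite coefM; apply: eq_bigr => i _.
rewrite pf ?qg //; first exact: leq_ltn_trans (leq_subr _ _) nN.
exact: leq_trans (ltn_ord i) nN.
Qed.

Fact fps_mulA : associative fps_mul.
Proof.
move=> f g h; apply: fpsP => n; pose t := trunc n.+1.
have tE k i : (i < n.+1)%N -> (t k)`_i = fpscoef k i by apply: truncE.
have tM k l i : (i < n.+1)%N -> (t k * t l)`_i = fpscoef (fps_mul k l) i.
  by move=> iN; apply: (coef_mul_trunc iN) => j; apply: tE.
transitivity ((t f * t g * t h)`_n).
  rewrite -mulrA; apply/esym/(coef_mul_trunc (ltnSn n)); [exact: tE|exact: tM].
by apply: (coef_mul_trunc (ltnSn n)); [exact: tM|exact: tE].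
Qed.

Fact fps_mulC : commutative fps_mul.
Proof.
move=> f g; apply: fpsP => n.
have M k l := coef_mul_trunc (ltnSn n) (@truncE _ k) (@truncE _ l).
by rewrite -!M mulrC.
Qed.

Fact fps_mul1 : left_id (fps_of_poly 1) fps_mul.
Proof.
move=> f; apply: fpsP => n.
rewrite -(@coef_mul_trunc n.+1 _ _ 1 (trunc n.+1 f)) ?mul1r ?truncE //.
by move=> i; apply: truncE.
Qed.

Fact fps_mulDl : left_distributive fps_mul fps_add.
Proof.
move=> f g h; apply: fpsP => n /=; rewrite -big_split /=.
by apply: eq_bigr => i _; rewrite mulrDl.
Qed.

Fact fps_oner_neq0 : fps_of_poly 1 != 0.
Proof.
apply/eqP => /(congr1 (fun f => fpscoef f 0)) /=.
by rewrite coef1 coef0; apply/eqP; rewrite oner_eq0.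
Qed.

HB.instance Definition _ := GRing.Zmodule_isComNzRing.Build (fps R)
  fps_mulA fps_mulC fps_mul1 fps_mulDl fps_oner_neq0.

(* The first n.+1 coefficients of 1/f, when the constant term is a unit. *)
Fixpoint fps_inv_seq f n : seq R :=
  if n is m.+1 then
    let s := fps_inv_seq f m in
    rcons s (- (fpscoef f 0)^-1 * \sum_(i < n) fpscoef f i.+1 * s`_(m - i))
  else [:: (fpscoef f 0)^-1].

Definition fps_unit : pred (fps R) := fun f => fpscoef f 0 \is a GRing.unit.
Definition fps_inv f :=
  if fps_unit f then FPS (fun n => (fps_inv_seq f n)`_n) else f.

Let size_inv_seq f n : size (fps_inv_seq f n) = n.+1.
Proof. by elim: n => //= n IHn; rewrite size_rcons IHn. Qed.

Let nth_inv_seq f n i : (i <= n)%N ->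
  (fps_inv_seq f n)`_i = (fps_inv_seq f i)`_i.
Proof.
elim: n => [|n IHn]; first by rewrite leqn0 => /eqP->.
rewrite leq_eqVlt => /predU1P[->//|]; rewrite ltnS => le_in.
by rewrite /= nth_rcons size_inv_seq ltnS le_in IHn.
Qed.

Fact fps_mulVr : {in fps_unit, left_inverse 1 fps_inv *%R}.
Proof.
move=> f Uf; rewrite mulrC; apply: fpsP => -[|n].
  rewrite /= big_ord_recl big_ord0 addr0 subn0 /fps_inv ifT //= coef1.
  exact: divrr.
rewrite [LHS]/= big_ord_recl subn0 {1}/fps_inv ifT //= coef1 /=.
rewrite nth_rcons size_inv_seq ltnn eqxx mulrA mulrN divrr // mulN1r.
apply/eqP; rewrite addrC subr_eq0; apply/eqP; apply: eq_bigr => i _.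
rewrite /bump /= add1n subSS /fps_inv ifT //=; congr (_ * _).
by rewrite [RHS]nth_inv_seq // leq_subr.
Qed.

Fact fps_unitP f g : g * f = 1 -> fps_unit f.
Proof.
move=> /(congr1 (fun h => fpscoef h 0)) /=.
rewrite big_ord_recl big_ord0 addr0 subn0 coef1 /= => gf1.
by apply/unitrPr; exists (fpscoef g 0); rewrite mulrC.
Qed.

Fact fps_invr_out : {in [predC fps_unit], fps_inv =1 id}.
Proof. by move=> f; rewrite /fps_inv /in_mem /= => /negbTE ->. Qed.

HB.instance Definition _ := GRing.ComNzRing_hasMulInverse.Build (fps R)
  fps_mulVr fps_unitP fps_invr_out.

Definition fps_sq f : fps R :=
  FPS (fun n => if odd n then 0 else fpscoef f n./2).

(* f is the expansion at the origin of a quotient of two polynomials *)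
Definition fps_rational f : Prop :=
  exists a b : {poly R},
    fps_of_poly b \is a GRing.unit /\ f = fps_of_poly a / fps_of_poly b.

End FpsRing.

(* The value 0 encodes an infinite label. *)
Definition coxeter_matrix (T : eqType) (m : T -> T -> nat) : Prop :=
  (forall s t, m s t = m t s) /\ (forall s t, (m s t == 1%N) = (s == t)).

Definition is_subgroup (W : groupType) (H : set W) : Prop :=
  H 1%g /\ forall x y, H x -> H y -> H (x^-1 * y)%g.

Section Coxeter.
Variables (W : groupType) (S : {fset W}).

Definition parabolic (I : {set S}) : set W :=
  smallest (@is_subgroup W) [set val s | s in [set` I]].

(* W is generated by S subject only to the relations (s t)^(m s t) = 1; for
   m s t = 0 the relation is void. *)
Definition coxeter_system : Prop :=
  exists2 m : S -> S -> nat, coxeter_matrix m &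
  [/\ parabolic finset.setT = [set: W],
      forall s t : S, ((val s * val t) ^+ m s t = 1)%g
    & forall (G : groupType) (f : S -> G),
        (forall s t : S, ((f s * f t) ^+ m s t = 1)%g) ->
        exists phi : {multiplicative W -> G}, forall s : S, phi (val s) = f s].

Definition is_word (w : W) (s : seq W) : Prop :=
  {subset s <= S} /\ (\prod_(x <- s) x)%g = w.

Definition cox_length (w : W) : nat :=
  xget 0%N [set n | (exists2 s, is_word w s & size s = n) /\
                    (forall s, is_word w s -> (n <= size s)%N)].

Definition involutions (I : {set S}) : set W :=
  [set z | parabolic I z /\ (z ^+ 2 = 1)%g].

Definition reflections (I : {set S}) : set W :=
  [set (w^-1 * val s * w)%g | w in parabolic I & s in [set` I]].

Definition genfun (A : set W) : fps rat :=
  FPS (fun n => #|` fset_set [set w | A w /\ cox_length w = n] |%:R).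

(* The value A(x), for a finite set A and an element x of a ring. *)
Definition genfun_at (F : comNzRingType) (A : set W) (x : F) : F :=
  \sum_(w \in A) x ^+ cox_length w.

Lemma genfun_poly (A : set W) : finite_set A ->
  genfun A = fps_of_poly (genfun_at A ('X : {poly rat})).
Proof.
move=> finA; apply: fpsP => n /=; rewrite /genfun_at fsbig_finite //= coef_sum.
under eq_bigr do rewrite coefXn.
rewrite -natr_sum; congr (_%:R).
have finl : finite_set [set w | A w /\ cox_length w = n].
  by apply: sub_finite_set finA => w [].
rewrite (perm_size (_ : perm_eq _ [seq w <- fset_set A | n == cox_length w])).
  rewrite size_filter -sum1_count big_mkcond; apply: eq_bigr => w _.
  by case: eqP.
apply: uniq_perm => [||w]; rewrite ?filter_uniq ?fset_uniq //.
rewrite mem_filter !in_fset_set //; apply/idP/andP => [/set_mem[Aw <-]|].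
  by rewrite eqxx; split=> //; apply: mem_set.
by case=> /eqP -> /set_mem Aw; apply: mem_set.
Qed.

Lemma is_word_ex : coxeter_system -> forall w, exists s, is_word w s.
Proof.
case=> m [_ m1] [gen rel _] w.
have : parabolic finset.setT w by rewrite gen.
move=> /(_ [set v | exists s, is_word v s]); apply; split; last first.
  move=> _ [x _ <-]; exists [:: val x]; split; last by rewrite big_seq1.
  by move=> y; rewrite inE => /eqP ->; apply: valP.
have inv x : x \in S -> (x^-1 = x)%g.
  move=> xS; pose t : S := [` xS]%fset.
  have /eqP mtt : m t t == 1%N by rewrite m1.
  have := rel t t; rewrite mtt expg1 /= => xx.
  by apply: (mulgI x); rewrite xx mulgV.
split; first by exists [::]; split=> //; rewrite big_nil.
move=> x y [s [sS <-]] [t [tS <-]]; exists (rev s ++ t); split.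
  by move=> z; rewrite mem_cat mem_rev => /orP[/sS|/tS].
rewrite big_cat /=; congr (_ * _)%g.
elim: s sS => [|a s IHs] sS; first by rewrite /= !big_nil invg1.
rewrite rev_cons -cats1 big_cat big_seq1 big_cons /= invgM (inv a).
  by rewrite IHs // => z zs; apply: sS; rewrite inE zs orbT.
by apply: sS; rewrite inE eqxx.
Qed.

Lemma cox_lengthP : coxeter_system -> forall w,
  (exists2 s, is_word w s & size s = cox_length w) /\
  (forall s, is_word w s -> (cox_length w <= size s)%N).
Proof.
move=> WS w; rewrite /cox_length; case: xgetP => [n _ []//|none].
have [s ws] := is_word_ex WS w.
have ex : exists n, `[< exists2 s, is_word w s & size s = n >].
  by exists (size s); apply/asboolP; exists s.
case: (ex_minnP ex) => n /asboolP wn min; case: (none n); split=> // t wt.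
by apply: min; apply/asboolP; exists t.
Qed.

Lemma finite_level : coxeter_system -> forall (A : set W) n,
  finite_set [set w | A w /\ cox_length w = n].
Proof.
move=> WS A n.
apply: (@sub_finite_set _ _
  [set (\prod_(x <- map val (t : n.-tuple S)) x)%g | t in [set: n.-tuple S]]).
  move=> w [_ lw]; have [[s [sS sw] szs] _] := cox_lengthP WS w.
  have : exists t : seq S, map val t = s.
    elim: s sS {sw szs} => [|a s IHs] sS; first by exists [::].
    have aS : a \in S by apply: sS; rewrite inE eqxx.
    case: IHs => [z zs|t <-]; first by apply: sS; rewrite inE zs orbT.
    by exists ([` aS]%fset :: t).
  case=> t ts; have szt : size t == n by rewrite -(size_map val) ts szs lw.
  by exists (Tuple szt) => //=; rewrite ts.
exact/finite_image/finite_finset.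
Qed.

Lemma genfun_parabolic_unit : coxeter_system -> forall I : {set S},
  fps_sq (genfun (parabolic I)) \is a GRing.unit.
Proof.
move=> WS I; change (fpscoef (genfun (parabolic I)) 0 \is a GRing.unit) => /=.
rewrite (_ : [set w | _] = [set 1%g]) ?fset_set1 ?cardfs1 ?unitr1 //.
apply/seteqP; split=> [w [_ lw]|_ ->] /=.
  have [[s [_ sw] szs] _] := cox_lengthP WS w.
  by move: szs sw; rewrite lw => /size0nil ->; rewrite big_nil.
split; first by move=> H [[]].
have [_ /(_ [::])] := cox_lengthP WS 1%g; rewrite leqn0 => l0.
by apply/eqP/l0; split=> //; rewrite big_nil.
Qed.

End Coxeter.

(* Main.v *)
Require Import Defs.
From HB Require Import structures.
From mathcomp Require Import all_boot all_order all_algebra finmap.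
From mathcomp Require Import boolp classical_sets functions cardinality fsbigop.
From mathcomp Require Import zify.

(** Clear denominators with W(q^2) = W^I(q^2) W_I(q^2) and replace a pair (w, z),
    with w minimal in w W_I and z in C_I, by the pair (w, x) with x = w z w^-1.  The
    alternating sum splits over the involutions x into
      f(x) = sum of (-1)^|I| q^(2 l(w) + l(w^-1 x w)),
    over the faces w W_I of the Coxeter complex that are fixed by x.  We show
      f(x) = (-1)^l(x) q^(-l(x)) f(1)
    for each x separately.  Here f(1) only sees elements without right ascents, so
    that f(1) = q^(2N) if W is finite and f(1) = 0 otherwise.

    The comparison of f(x) with f(1) goes by induction on l(x): for a left descent r
    of x put y = r x r if this is not x, and y = r x otherwise.  Translation by r
    matches the faces of x with those of y and shifts the exponent by an amount that
    depends on the side of the wall of r.  The induction therefore also asserts that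
    the sum over the fixed faces in an intersection of half-spaces vanishes, as soon
    as there is at least one half-space and each of them contains both the
    fundamental chamber and its image under x.

    Everything is done inside a standard parabolic subgroup W_J, so that rationality
    follows from the recurrences by induction on |J|; the class {1} gives the
    recurrence for 1 / W_J(q^2). *)

Set Implicit Arguments.
Unset Strict Implicit.
Unset Printing Implicit Defensive.

Import GRing.Theory.
Local Open Scope classical_set_scope.

(* The semidirect product of W with the subsets of W under symmetric difference; the
   homomorphism from W sending each generator s to (s, {s}) attaches to w the set of
   its left inversions. *)
Record twisted (W : groupType) := Twisted { tw_val : W; tw_set : W -> bool }.

HB.instance Definition _ (W : groupType) := gen_eqMixin (twisted W).
HB.instance Definition _ (W : groupType) := gen_choiceMixin (twisted W).

Section TwistedGroup.
Local Open Scope group_scope.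
Variable W : groupType.
Implicit Types f g h : twisted W.

Lemma twistedP f g :
  tw_val f = tw_val g -> (forall t, tw_set f t = tw_set g t) -> f = g.
Proof. by case: f g => [u a] [v b] /= -> /funext ->. Qed.

Definition twisted1 := Twisted (1 : W) (fun=> false).
Definition twisted_inv f :=
  Twisted (tw_val f)^-1 (fun t => tw_set f (t ^ (tw_val f)^-1)).
Definition twisted_mul f g :=
  Twisted (tw_val f * tw_val g)
    (fun t => tw_set f t (+) tw_set g (t ^ tw_val f)).

Fact twisted_mulA : associative twisted_mul.
Proof.
by move=> f g h; apply: twistedP => [|t] /=; rewrite ?mulgA // addbA conjgM.
Qed.
Fact twisted_mul1 : left_id twisted1 twisted_mul.
Proof. by move=> f; apply: twistedP => [|t] /=; rewrite ?mul1g // conjg1. Qed.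
Fact twisted_mulg1 : right_id twisted1 twisted_mul.
Proof. by move=> f; apply: twistedP => [|t] /=; rewrite ?mulg1 // addbF. Qed.
Fact twisted_mulV : left_inverse twisted1 twisted_inv twisted_mul.
Proof. by move=> f; apply: twistedP => [|t] /=; rewrite ?mulVg // addbb. Qed.
Fact twisted_mulgV : right_inverse twisted1 twisted_inv twisted_mul.
Proof.
by move=> f; apply: twistedP => [|t] /=; rewrite ?mulgV // conjgK addbb.
Qed.

HB.instance Definition _ := isGroup.Build (twisted W)
  twisted_mulA twisted_mul1 twisted_mulg1 twisted_mulV twisted_mulgV.

Lemma tw_valM f g : tw_val (f * g) = tw_val f * tw_val g.
Proof. by []. Qed.

Lemma tw_setM f g t :
  tw_set (f * g) t = tw_set f t (+) tw_set g (t ^ tw_val f).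
Proof. by []. Qed.

Lemma tw_valX f n : tw_val (f ^+ n) = tw_val f ^+ n.
Proof. by elim: n => // n IHn; rewrite !expgS tw_valM IHn. Qed.

Lemma tw_setX f n t :
  tw_set (f ^+ n) t = \big[addb/false]_(i < n) tw_set f (t ^ (tw_val f ^+ i)).
Proof.
elim: n => [|n IHn]; first by rewrite big_ord0.
by rewrite expgSr tw_setM IHn big_ord_recr tw_valX.
Qed.

(* The reflections met along the word (s t)^m are (s t)^j s for j < 2m, and each
   is met twice. *)
Lemma twisted_braid (s t : W) m :
  s * s = 1 -> t * t = 1 -> (s * t) ^+ m = 1 ->
  (Twisted s (eq_op^~ s) * Twisted t (eq_op^~ t)) ^+ m = 1.
Proof.
move=> ss tt stm; set z := s * t.
have sV : s^-1 = s by apply: mulg1_eq.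
have tV : t^-1 = t by apply: mulg1_eq.
have zs i : s * z ^- i = z ^+ i * s.
  have <- : (z ^+ i) ^ s = z ^- i.
    by rewrite conjXg conjgE sV /z -!mulgA (mulgA s s) ss mul1g -expVgn invgM sV tV.
  by rewrite conjgE mulVKg.
apply: twistedP => [|x]; first by rewrite tw_valX.
rewrite tw_setX /= -/z.
transitivity (\big[addb/false]_(i < m) ((x == z ^+ i.*2 * s)
                          (+) (x == z ^+ i.*2.+1 * s))).
  apply: eq_bigr => i _; rewrite -conjgM; congr (_ (+) _).
    rewrite -(inj_eq (conjg_inj (z ^- i))) conjgK; congr (_ == _).
    by rewrite conjgE invgK zs mulgA -expgnDr addnn.
  rewrite -(inj_eq (conjg_inj (z ^+ i * s)^-1)) conjgK; congr (_ == _).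
  rewrite conjgE invgK invgM sV -!mulgA zs.
  have -> : s * (t * (z ^+ i * s)) = z * (z ^+ i * s) by rewrite /z !mulgA.
  by rewrite [z * _]mulgA -expgS mulgA -expgnDr addnS addnn.
transitivity (\big[addb/false]_(0 <= j < m.*2) (x == z ^+ j * s)).
  elim: (m) => [|n IHn]; first by rewrite big_ord0 big_nil.
  by rewrite big_ord_recr IHn doubleS !big_nat_recr //= addbA.
rewrite -addnn (@big_cat_nat _ _ _ m) ?leq_addr //= -{2}[m]add0n big_addn.
rewrite addnK -[RHS](addbb (\big[addb/false]_(0 <= j < m) (x == z ^+ j * s))).
by congr (_ (+) _); apply: eq_bigr => i _; rewrite expgnDr stm mulg1.
Qed.

End TwistedGroup.

(** * Inversions and minimal coset representatives *)

Section CoxeterGroup.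
Local Open Scope group_scope.
Variables (W : groupType) (S : {fset W}).
Hypothesis WS : coxeter_system S.
Implicit Types (u v w x t : W) (a : S) (s : seq S) (I J : {set S}).

Local Notation len := (cox_length S).

Definition word s : W := \prod_(a <- s) val a.

Lemma word_cat s1 s2 : word (s1 ++ s2) = word s1 * word s2.
Proof. exact: big_cat. Qed.

Lemma word_cons a s : word (a :: s) = val a * word s.
Proof. exact: big_cons. Qed.

Lemma word_nil : word [::] = 1.
Proof. exact: big_nil. Qed.

Lemma gen_sq a : val a * val a = 1.
Proof.
case: WS => m [_ m1] [_ rel _].
by have /eqP maa : m a a == 1%N; [rewrite m1|have := rel a a; rewrite maa expg1].
Qed.

Lemma gen_inv a : (val a)^-1 = val a.
Proof. exact/mulg1_eq/gen_sq. Qed.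

Lemma word_rev s : word (rev s) = (word s)^-1.
Proof.
elim: s => [|a s IHs]; first by rewrite word_nil invg1.
by rewrite rev_cons -cats1 word_cat !word_cons word_nil mulg1 IHs invgM gen_inv.
Qed.

Lemma length_word s : (len (word s) <= size s)%N.
Proof.
rewrite -(size_map val); apply: (cox_lengthP WS _).2; split; last by rewrite big_map.
by move=> _ /mapP[a _ ->]; apply: valP.
Qed.

Lemma reduced_word w : exists2 s, word s = w & size s = len w.
Proof.
have [[r [rS rw] <-] _] := cox_lengthP WS w.
have [s rE] : exists s, map val s = r.
  elim: r rS {rw} => [|y r IHr] rS; first by exists [::].
  have yS : y \in S by apply: rS; rewrite inE eqxx.
  case: IHr => [z zr|s <-]; first by apply: rS; rewrite inE zr orbT.
  by exists ([` yS]%fset :: s).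
by exists s; rewrite -?rE ?size_map // -rw -rE big_map.
Qed.

Lemma parabolicP I w :
  parabolic I w <-> exists2 s, all (mem I) s & word s = w.
Proof.
split=> [Iw|[s Is <-] H [[H1 HV] HI]]; last first.
  elim: s Is => [|a s IHs] /=; first by rewrite word_nil.
  case/andP=> Ia /IHs Hs; rewrite word_cons -(gen_inv a); apply: HV => //.
  by apply: HI; exists a.
apply: (Iw [set v | exists2 s, all (mem I) s & word s = v]).
split; last first.
  by move=> _ [a Ia <-]; exists [:: a]; rewrite ?word_cons ?word_nil ?mulg1 //= andbT.
split; first by exists [::]; rewrite ?word_nil.
move=> _ _ [s1 I1 <-] [s2 I2 <-]; exists (rev s1 ++ s2).
  by rewrite all_cat all_rev I1.
by rewrite word_cat word_rev.
Qed.

Lemma parabolic1 I : parabolic I 1.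
Proof. by apply/parabolicP; exists [::]; rewrite ?word_nil. Qed.

Lemma parabolicM I u v : parabolic I u -> parabolic I v -> parabolic I (u * v).
Proof.
move=> /parabolicP[s1 I1 <-] /parabolicP[s2 I2 <-]; apply/parabolicP.
by exists (s1 ++ s2); rewrite ?word_cat // all_cat I1.
Qed.

Lemma parabolicV I u : parabolic I u -> parabolic I u^-1.
Proof.
move=> /parabolicP[s Is <-]; apply/parabolicP.
by exists (rev s); rewrite ?word_rev ?all_rev.
Qed.

Lemma parabolic_gen I a : a \in I -> parabolic I (val a).
Proof.
move=> Ia; apply/parabolicP.
by exists [:: a]; rewrite ?word_cons ?word_nil ?mulg1 //= andbT.
Qed.

Lemma parabolicJ I u v : parabolic I u -> parabolic I v -> parabolic I (u ^ v).
Proof. by move=> Iu Iv; do 2?apply: parabolicM => //; apply: parabolicV. Qed.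

Lemma parabolicS I J w : I \subset J -> parabolic I w -> parabolic J w.
Proof.
move=> IJ /parabolicP[s Is <-]; apply/parabolicP; exists s => //.
by apply: sub_all Is => a; apply: (fintype.subsetP IJ).
Qed.

Lemma parabolicMl I u v : parabolic I u -> (parabolic I (u * v) <-> parabolic I v).
Proof.
move=> Iu; split=> [/(parabolicM (parabolicV Iu))|]; first by rewrite mulKg.
exact: parabolicM.
Qed.

Lemma length1 : len 1 = 0%N.
Proof. by apply/eqP; rewrite -leqn0 -word_nil length_word. Qed.

Lemma length0 w : len w = 0%N -> w = 1.
Proof. by case: (reduced_word w) => s <- <- /size0nil ->; rewrite word_nil. Qed.

Lemma lengthM u v : (len (u * v) <= len u + len v)%N.
Proof.
have [s <- <-] := reduced_word u; have [s' <- <-] := reduced_word v.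
by rewrite -word_cat -size_cat length_word.
Qed.

Lemma lengthV u : len u^-1 = len u.
Proof.
suff le v : (len v^-1 <= len v)%N by apply/eqP; rewrite eqn_leq le -{1}(invgK u) le.
by have [s <- <-] := reduced_word v; rewrite -word_rev -(size_rev s) length_word.
Qed.

Lemma length_gen_le a : (len (val a) <= 1)%N.
Proof. by have := length_word [:: a]; rewrite word_cons word_nil mulg1. Qed.

Definition is_reflection t := exists w a, t = val a ^ w.

(* Left inversions, i.e. the reflections whose wall separates the fundamental chamber
   from the chamber w. *)
Definition inversion w t : bool :=
  `[< is_reflection t >] && (len (t * w) < len w)%N.

Let inversion_spec (N : W -> W -> bool) :=
  [/\ forall t, N 1 t = false, forall a t, N (val a) t = (t == val a)
    & forall u v t, N (u * v) t = N u t (+) N v (t ^ u)].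

(** The universal property of the presentation enters here: [twisted_braid] checks the relations for
    the pairs (s, {s}), and N is the second component of the resulting homomorphism. *)
Lemma inversion_exists : exists N, inversion_spec N.
Proof.
case: (WS) => m _ [gen rel univ].
pose f a := Twisted (val a) (eq_op^~ (val a)).
have [|phi phiE] := univ _ f.
  by move=> a b; apply: twisted_braid; rewrite ?gen_sq.
have phi1 : phi 1 = 1 by apply: (mulgI (phi 1)); rewrite -gmulfM !mulg1.
have valphi w : tw_val (phi w) = w.
  have: [set: W] w by [].
  rewrite -gen => /parabolicP[s _ <-].
  elim: s => [|a s IHs]; first by rewrite word_nil phi1.
  by rewrite word_cons gmulfM phiE tw_valM IHs.
exists (fun w => tw_set (phi w)); split=> [t|a t|u v t].
- by rewrite phi1.
- by rewrite phiE.
by rewrite gmulfM tw_setM valphi.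
Qed.

(** With [word_delete] this is the exchange condition: t is the wall crossed at some letter a, and
    multiplying by t erases that letter. *)
Lemma inversion_split N s t : inversion_spec N -> N (word s) t ->
  exists s1 a s2, s = s1 ++ a :: s2 /\ t = val a ^ (word s1)^-1.
Proof.
move=> [N1 Ng NM]; elim: s t => [|a s IHs] t; first by rewrite word_nil N1.
rewrite word_cons NM Ng; case: eqVneq => [-> _|_ /= /IHs[s1 [b [s2 [-> tE]]]]].
  by exists [::], a, s; rewrite word_nil invg1 conjg1.
exists (a :: s1), b, s2; split=> //.
by rewrite word_cons invgM conjgM -tE conjgK.
Qed.

Lemma word_delete s1 a s2 :
  val a ^ (word s1)^-1 * word (s1 ++ a :: s2) = word (s1 ++ s2).
Proof.
rewrite !word_cat word_cons conjgE invgK -!mulgA mulKg.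
by rewrite (mulgA (val a)) gen_sq mul1g.
Qed.

(** Erasing a letter shows that the members of N w shorten w. Conversely t lies in N t, so if t is
    not in N w it is in N (t w), and then w = t (t w) is shorter than t w. *)
Lemma inversionE N : inversion_spec N -> N = inversion.
Proof.
move=> spec; have [N1 Ng NM] := spec; apply/funext => w; apply/funext => t.
have dec v : N v t -> is_reflection t /\ (len (t * v) < len v)%N.
  have [s <- <-] := reduced_word v.
  move=> /(inversion_split spec)[s1 [a [s2 [-> ->]]]].
  split; first by exists (word s1)^-1, a.
  rewrite word_delete (leq_ltn_trans (length_word _)) // !size_cat /=.
  by rewrite addnS.
apply/idP/andP => [/dec[rt lt]|[/asboolP rt lt]]; first by split=> //; apply/asboolP.
apply: contraTT lt => Nwt; rewrite -leqNgt ltnW //.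
have [u [a tE]] := rt.
have tt : t * t = 1 by rewrite tE -conjMg gen_sq conj1g.
suff /dec[_] : N (t * w) t by rewrite mulgA tt mul1g.
have tJt : t ^ t = t by rewrite conjgE mulKg.
rewrite NM tJt (negPf Nwt) addbF.
have NV x y : N x^-1 y = N x (y ^ x^-1).
  by have := NM x^-1 x y; rewrite mulVg N1; case: (N _ _); case: (N _ _).
have -> : N t t = N (u^-1 * (val a * u)) t by rewrite -conjgE -tE.
(* Along t = u^-1 a u the two contributions of u cancel and a contributes once. *)
rewrite NM NV {2}tE tE conjgK NM Ng eqxx conjgE mulKg.
by case: (N u (val a)).
Qed.

Lemma inversion1 t : inversion 1 t = false.
Proof. by have [N spec] := inversion_exists; rewrite -(inversionE spec); case:
  spec. Qed.

Lemma inversion_gen a t : inversion (val a) t = (t == val a).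
Proof. by have [N spec] := inversion_exists; rewrite -(inversionE spec); case:
  spec. Qed.

Lemma inversionM u v t : inversion (u * v) t = inversion u t (+) inversion v (t ^ u).
Proof. by have [N spec] := inversion_exists; rewrite -(inversionE spec); case:
  spec. Qed.

Lemma inversionV w t : inversion w^-1 t = inversion w (t ^ w^-1).
Proof.
have := inversionM w^-1 w t; rewrite mulVg inversion1.
by case: (inversion _ _); case: (inversion _ _).
Qed.

Lemma inversion_length w t : inversion w t -> (len (t * w) < len w)%N.
Proof. by case/andP. Qed.

Lemma inversion_word s t : inversion (word s) t ->
  exists s1 a s2, s = s1 ++ a :: s2 /\ t = val a ^ (word s1)^-1.
Proof.
have [N spec] := inversion_exists; rewrite -(inversionE spec).
exact: inversion_split spec.
Qed.

Lemma reflection_gen a : is_reflection (val a).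
Proof. by exists 1, a; rewrite conjg1. Qed.

Lemma reflectionJ t w : is_reflection t -> is_reflection (t ^ w).
Proof. by case=> u [a ->]; exists (u * w), a; rewrite conjgM. Qed.

Lemma reflection_sq t : is_reflection t -> t * t = 1.
Proof. by case=> w [a ->]; rewrite -conjMg gen_sq conj1g. Qed.

Lemma reflection_self t : is_reflection t -> inversion t t.
Proof.
move=> rt; rewrite /inversion asboolT // reflection_sq // length1 lt0n.
apply/eqP => /length0 t1; have [w [a ta]] := rt.
have := inversion_gen a (val a); rewrite eqxx.
by rewrite -(conjgK w (val a)) -ta t1 conj1g inversion1.
Qed.

(** The wall of a is an inversion of exactly one of w and a w, so the two lengths differ, and they
    differ by at most one. *)
Lemma length_genMl a w :
  len (val a * w) = if inversion w (val a) then (len w).-1 else (len w).+1.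
Proof.
have up v : (len (val a * v) <= (len v).+1)%N.
  by apply: leq_trans (lengthM _ _) _; rewrite addnC -addn1 leq_add2l length_gen_le.
have down v : inversion v (val a) -> (len (val a * v)).+1 = len v.
  move=> /inversion_length lt; apply/eqP; rewrite eqn_leq lt /=.
  by rewrite -{1}(mul1g v) -(gen_sq a) -mulgA up.
case: ifP => iw; first by rewrite -(down w).
have /down : inversion (val a * w) (val a).
  by rewrite inversionM inversion_gen eqxx conjgE mulKg iw.
by rewrite mulgA gen_sq mul1g => ->.
Qed.

Lemma length_genMr a w :
  len (w * val a) = if inversion w^-1 (val a) then (len w).-1 else (len w).+1.
Proof. by rewrite -lengthV invgM gen_inv length_genMl lengthV. Qed.

Lemma parabolic_inversion I w t : parabolic I w -> inversion w t -> parabolic I t.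
Proof.
move=> /parabolicP[s Is <-] /inversion_word[s1 [a [s2 [sE ->]]]].
move: Is; rewrite sE all_cat /= => /and3P[I1 Ia _].
apply: parabolicJ; first exact: parabolic_gen.
by apply: parabolicV; apply/parabolicP; exists s1.
Qed.

Definition min_rep I w := forall u, parabolic I u -> (len w <= len (w * u))%N.

Lemma min_rep_inversionV I w u : min_rep I w -> parabolic I u ->
  inversion w^-1 u = false.
Proof.
move=> mw Iu; apply/negP => /inversion_length; rewrite ltnNge => /negP[].
by rewrite lengthV -[in X in (_ <= X)%N]lengthV invgM invgK mw //; apply: parabolicV.
Qed.

Lemma min_rep_inversion I w u : min_rep I w -> parabolic I u ->
  inversion w (u ^ w^-1) = false.
Proof. by rewrite -inversionV; exact: min_rep_inversionV. Qed.

Lemma min_rep1 I : min_rep I 1.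
Proof. by move=> u _; rewrite length1. Qed.

(** If appending a letter lowered the length, minimality of w would place the inversion in the word
    s, and the exchange condition would shorten the extended word over I. Minimality of s is asked
    only among words over I, so that the case w = 1 yields [reduced_parabolic_word]. *)
Lemma min_rep_length_word I w s : min_rep I w -> all (mem I) s ->
  (forall s', all (mem I) s' -> word s' = word s -> size s <= size s')%N ->
  len (w * word s) = (len w + size s)%N.
Proof.
move=> mw; elim/last_ind: s => [|s a IHs] Is mins.
  by rewrite word_nil mulg1 addn0.
have rconsE r : word (rcons r a) = word r * val a.
  by rewrite -cats1 word_cat word_cons word_nil mulg1.
move: Is; rewrite all_rcons => /andP[Ia Is].
have {}IHs : len (w * word s) = (len w + size s)%N.
  apply: IHs => // s' Is' ss'; have := mins (rcons s' a).
  by rewrite all_rcons !size_rcons Is' andbT !rconsE ss'; apply.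
rewrite rconsE mulgA length_genMr IHs size_rcons addnS.
rewrite inversionV inversionM invgM conjgM (min_rep_inversion mw) //; last first.
  apply: parabolicJ; first exact: parabolic_gen.
  by apply: parabolicV; apply/parabolicP; exists s.
case: ifP => //; rewrite conjgKV => /inversion_word[s1 [b [s2 [sE tE]]]].
have := mins (s1 ++ s2); rewrite size_rcons sE !size_cat /= addnS.
move: Is; rewrite sE !all_cat => /= /and3P[-> _ ->] /(_ isT).
rewrite rconsE -(word_delete s1 b s2) -tE -sE conjgE invgK -!mulgA mulVg mulg1.
move=> /(_ erefl).
by rewrite ltnNge leqnSn.
Qed.

Lemma reduced_parabolic_word I u : parabolic I u ->
  exists s, [/\ all (mem I) s, word s = u & size s = len u].
Proof.
move=> /parabolicP ex.
have exn : exists n, `[< exists2 s, all (mem I) s & word s = u /\ size s = n >].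
  by have [s Is su] := ex; exists (size s); apply/asboolP; exists s.
case: (ex_minnP exn) => _ /asboolP[s Is [su <-]] mins; exists s; split=> //.
have {}mins s' : all (mem I) s' -> word s' = word s -> (size s <= size s')%N.
  by move=> Is' ss'; apply: mins; apply/asboolP; exists s'; rewrite // -su.
by have := min_rep_length_word (@min_rep1 I) Is mins; rewrite mul1g length1 su.
Qed.

Lemma min_rep_lengthD I w u :
  min_rep I w -> parabolic I u -> len (w * u) = (len w + len u)%N.
Proof.
move=> mw Iu; have [s [Is su szs]] := reduced_parabolic_word Iu.
rewrite -{1}su (min_rep_length_word mw) ?szs // => s' _.
by rewrite su => <-; apply: length_word.
Qed.

Lemma parabolic_descent I u :
  parabolic I u -> u <> 1 -> exists2 a, a \in I & inversion u (val a).
Proof.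
case/reduced_parabolic_word=> [[|a s]] [/= Is su szs] u1.
  by case: u1; rewrite -su word_nil.
case/andP: Is => Ia _; exists a => //; apply: contraT => inv.
have := length_word s; have := length_genMl a (word s).
rewrite -word_cons su -szs.
have -> : inversion (word s) (val a).
  move: inv; rewrite -su word_cons inversionM inversion_gen eqxx conjgE mulKg.
  by case: (inversion _ _).
by move=> sz le; move: (leq_pred (len (word s))); rewrite -sz ltnNge le.
Qed.

Lemma min_rep_exists I w : exists2 u, parabolic I u & min_rep I (w * u).
Proof.
have exn : exists n, `[< exists2 u, parabolic I u & len (w * u) = n >].
  by exists (len w); apply/asboolP; exists 1; rewrite ?mulg1 //; apply: parabolic1.
case: (ex_minnP exn) => _ /asboolP[u Iu <-] minu; exists u => // v Iv.
by apply: minu; apply/asboolP; exists (u * v); rewrite ?mulgA //; apply: parabolicM.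
Qed.

Lemma min_rep_uniq I w u :
  min_rep I w -> parabolic I u -> min_rep I (w * u) -> u = 1.
Proof.
move=> mw Iu mwu; apply: length0.
have := min_rep_lengthD mwu (parabolicV Iu); rewrite mulgK lengthV.
rewrite (min_rep_lengthD mw Iu) -addnA => /esym/eqP.
by rewrite -[X in _ == X]addn0 eqn_add2l addn_eq0 andbb => /eqP.
Qed.

(** If w u is minimal with u nontrivial in W_I, a left descent a of u makes w a = (w u)(u^-1 a)
    shorter than w, because lengths add on the coset. *)
Lemma min_rep_genP I w :
  min_rep I w <-> forall a, a \in I -> inversion w^-1 (val a) = false.
Proof.
split=> [mw a Ia|asc]; first exact: min_rep_inversionV mw (parabolic_gen Ia).
have [u Iu mwu] := min_rep_exists I w.
suff u1 : u = 1 by rewrite -(mulg1 w) -u1.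
apply/notP => u1; have [a Ia ua] := parabolic_descent Iu u1.
have uV : parabolic I (u^-1 * val a).
  by apply: parabolicM; [apply: parabolicV|apply: parabolic_gen].
have := min_rep_lengthD mwu uV; rewrite mulgA mulgK length_genMr asc //.
have := inversion_length ua; rewrite length_genMr invgK ua lengthV.
have := min_rep_lengthD mwu (parabolicV Iu); rewrite mulgK lengthV => -> ? /eqP.
by rewrite eqn_leq; case: (len u) => // n; lia.
Qed.

End CoxeterGroup.

(** * Cardinalities of finite sets *)

Definition ncard (T : choiceType) (A : set T) : nat := #|` fset_set A|%fset.

Section NcardTheory.
Variables (T U : choiceType).
Implicit Types (A B : set T).

Lemma ncard0 A : (forall x, ~ A x) -> ncard A = 0%N.
Proof.
by move=> A0; rewrite (_ : A = set0) ?/ncard ?fset_set0 //; apply/seteqP;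
  split=> // x /A0.
Qed.

Lemma ncard1 A x : (forall y, A y <-> y = x) -> ncard A = 1%N.
Proof.
move=> Ax; rewrite (_ : A = [set x]) ?/ncard ?fset_set1 ?cardfs1 //.
by apply/seteqP; split=> y /Ax.
Qed.

Lemma ncardE A : finite_set A -> ncard A = (\big[addn/0]_(x \in A) 1)%N.
Proof. by move=> fA; rewrite fsbig_finite // sum1_size. Qed.

Lemma ncard_split B A : finite_set A ->
  ncard A = (ncard (A `&` B) + ncard (A `&` ~` B))%N.
Proof.
by move=> fA; rewrite !ncardE; [exact: fsbigID|apply: finite_setIl..|].
Qed.

Lemma ncard_bij (A : set T) (B : set U) (f : T -> U) (g : U -> T) :
    finite_set A ->
    (forall x, A x -> B (f x) /\ g (f x) = x) ->
    (forall y, B y -> A (g y) /\ f (g y) = y) ->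
  ncard A = ncard B.
Proof.
move=> fA AB BA; have BE : B = [set f x | x in A].
  apply/seteqP; split=> [y /BA[Ay <-]|_ [x /AB[Bx _] <-] //].
  by exists (g y).
rewrite /ncard BE fset_set_image // card_in_imfset //= => x y.
rewrite !in_fset_set // => /set_mem /AB[_ gx] /set_mem /AB[_ gy] fxy.
by rewrite -gx fxy gy.
Qed.

End NcardTheory.

(** * Faces fixed by an involution *)

Section Faces.
Local Open Scope ring_scope.
Local Open Scope group_scope.
Variables (W : groupType) (S : {fset W}).
Hypothesis WS : coxeter_system S.
Implicit Types (u v w x y t : W) (a r : S) (I J : {set S}) (G : set W).

Local Notation len := (cox_length S).
Local Notation inversion := (@inversion W S).

Lemma conjgg t : t ^ t = t.
Proof. by rewrite conjgE mulKg. Qed.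

Lemma gen_neq1 a : val a <> 1.
Proof.
move=> a1; have := inversion_gen WS a (val a).
by rewrite eqxx {1}a1 inversion1.
Qed.

(* Left multiplication by r permutes the cosets of W_I; [face_step r I] follows
   this action on minimal representatives. *)
Definition face_step r I w :=
  if `[< min_rep I (val r * w) >] then val r * w else w.

Variant face_step_spec r I w : W -> Prop :=
| FaceMove of min_rep I (val r * w) & ~ parabolic I (val r ^ w) :
    face_step_spec r I w (val r * w)
| FaceFix a of a \in I & val r ^ w = val a & ~~ inversion w (val r) :
    face_step_spec r I w w.

(** If r w is not minimal, it has a right descent a in I. Since a is no descent of w, only the wall
    of r can account for it, which forces r w = w a (Deodhar's lemma). *)
Lemma face_stepP r I w : min_rep I w -> face_step_spec r I w (face_step r I w).
Proof.
move=> mw; rewrite /face_step; case: asboolP => mrw.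
  constructor=> // Irw; apply: (@gen_neq1 r).
  have rw : w * (val r ^ w) = val r * w by rewrite conjgE mulVKg.
  have := min_rep_uniq WS mw Irw; rewrite rw => /(_ mrw) /eqP.
  by rewrite conjg_eq1 => /eqP.
have [a Ia inv] : exists2 a, a \in I & inversion (val r * w)^-1 (val a).
  apply/notP => none; apply/mrw/(min_rep_genP WS) => a Ia.
  by apply/negbTE/negP => inv; apply: none; exists a.
move: inv; rewrite (inversionV WS) (inversionM WS) (inversion_gen WS).
rewrite invgM conjgM gen_inv //.
rewrite -[X in inversion w X]conjgM gen_sq // conjg1 (min_rep_inversion WS mw);
  last first.
  exact: parabolic_gen.
rewrite addbF => /eqP aE; have {}aE : val a ^ w^-1 = val r.
  by rewrite -(conjgK (val r) (val a ^ w^-1)) gen_inv // aE conjgE mulKg.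
apply: (@FaceFix _ _ _ a) => //; first by rewrite -aE conjgKV.
by rewrite -aE (min_rep_inversion WS mw) //; apply: parabolic_gen.
Qed.

Lemma face_step_min r I w : min_rep I w -> min_rep I (face_step r I w).
Proof. by move=> mw; case: face_stepP. Qed.

Lemma face_stepK r I w : min_rep I w -> face_step r I (face_step r I w) = w.
Proof.
move=> mw; case: (face_stepP r mw) => [mrw _|a Ia rw _].
  by rewrite /face_step mulgA gen_sq // mul1g asboolT.
case: (face_stepP r mw) => // _ []; rewrite rw; exact: parabolic_gen.
Qed.

Lemma face_step_parabolic J r I w :
  r \in J -> parabolic J w -> parabolic J (face_step r I w).
Proof.
by move=> Jr Jw; rewrite /face_step; case: ifP => // _; apply: parabolicM => //; apply:
  parabolic_gen.
Qed.

(** Translation by r carries the sides of a wall t other than its own to those of r t r. If the face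
    is fixed, then w = r w a, and the factors r and a affect only the wall of r. *)
Lemma face_step_inversion r I w t : min_rep I w -> t <> val r ->
  inversion (face_step r I w) (t ^ val r) = inversion w t.
Proof.
move=> mw tr; have rKr u : (u ^ val r) ^ val r = u by rewrite -conjgM gen_sq // conjg1.
have tr' : (t ^ val r == val r) = false.
  apply/negbTE/eqP => tr'; apply: tr.
  by rewrite -(rKr t) tr' conjgE mulKg.
case: (face_stepP r mw) => [_ _|a Ia rw _].
  by rewrite (inversionM WS) (inversion_gen WS) tr' rKr.
have {1}-> : w = val r * (w * val a).
  by rewrite -rw conjgE mulVKg mulgA gen_sq // mul1g.
rewrite (inversionM WS) (inversion_gen WS) tr' rKr (inversionM WS).
rewrite (inversion_gen WS) -rw (inj_eq (conjg_inj w)).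
by case: eqP tr => // _ _; rewrite addbF.
Qed.

Lemma involution_inv y : y * y = 1 -> y^-1 = y.
Proof. exact: mulg1_eq. Qed.

Lemma involution_inversion y t : y * y = 1 -> inversion y (t ^ y) = inversion y t.
Proof. by move=> /involution_inv yV; have := inversionV WS y t; rewrite yV. Qed.

Lemma involutionJ y w : y * y = 1 -> (y ^ w) * (y ^ w) = 1.
Proof. by move=> yy; rewrite -conjMg yy conj1g. Qed.

Lemma involution_length_genJ u a : u * u = 1 -> ~~ inversion u (val a) ->
  u ^ val a <> u -> len (u ^ val a) = (len u).+2.
Proof.
move=> uu nua ua; rewrite conjgE gen_inv // length_genMl // length_genMr //.
rewrite involution_inv // (negPf nua) (inversionM WS) (inversion_gen WS) (negPf nua).
case: eqP => // aE; case: ua.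
have : commute (val a) u by rewrite /commute conjgC [in LHS]aE.
by move=> /commute_sym cua; rewrite conjgE cua mulKg.
Qed.

(** Both r and y fix the face. Write y w = w u with u in W_I and test the reflection [val r ^ y] on
    both sides: on the left it is no inversion, as r is one of neither y nor w; on the right w
    contributes nothing, which leaves a tested on u. *)
Lemma face_ascent y r I w a : y * y = 1 -> ~~ inversion y (val r) ->
  min_rep I w -> a \in I -> val r ^ w = val a -> ~~ inversion w (val r) ->
  parabolic I (y ^ w) -> ~~ inversion (y ^ w) (val a).
Proof.
move=> yy nyr mw Ia rw nwr Iyw; have uu := involutionJ w yy.
have yw : y * w = w * (y ^ w) by rewrite conjgE mulVKg.
have E : val r ^ y = (val a ^ (y ^ w)) ^ w^-1.
  by rewrite -conjgM -rw -conjgM mulgA -yw mulgK.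
have := inversionM WS y w (val r ^ y).
have -> : (val r ^ y) ^ y = val r by rewrite -conjgM yy conjg1.
rewrite involution_inversion // (negPf nyr) (negPf nwr) yw (inversionM WS).
rewrite E (min_rep_inversion WS mw) ?conjgKV /=; last first.
  by apply: parabolicJ => //; apply: parabolic_gen.
by rewrite involution_inversion //; case: (inversion _ _).
Qed.

(* When x fixes w W_I and w is minimal in it, this is l(x) plus twice the number of
   walls that separate w W_I from both 1 and x. *)
Definition face_stat x w := (2 * len w + len (x ^ w))%N.

(* The minimal representatives w of the cosets w W_I in W_J/W_I that x fixes and
   that lie, for every reflection in G, on the same side as 1. *)
Definition faces J x G I (n : int) : set W :=
  [set w | [/\ parabolic J w, min_rep I w, parabolic I (x ^ w),
               (forall t, G t -> inversion w t = false)
             & (face_stat x w)%:Z = n]].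

Lemma finite_length n : finite_set [set w | (len w <= n)%N].
Proof.
elim: n => [|n IHn].
  apply: sub_finite_set (finite_level WS setT 0) => w /=.
  by rewrite leqn0 => /eqP.
have -> : [set w | (len w <= n.+1)%N] =
    [set w | (len w <= n)%N] `|` [set w | setT w /\ len w = n.+1].
  apply/seteqP; split=> w /=; last by case=> [/leqW|[_ ->]].
  by rewrite leq_eqVlt ltnS => /orP[/eqP|]; [right|left].
by rewrite finite_setU; split=> //; apply: finite_level WS setT n.+1.
Qed.

Lemma finite_faces J x G I n : finite_set (faces J x G I n).
Proof.
apply: sub_finite_set (finite_length `|n|) => w [_ _ _ _ <-] /=.
by rewrite /face_stat mulSn mul1n -!addnA leq_addr.
Qed.

(* With G the set of walls of a family of half-spaces, [conj_refl] translates the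
   family by r and [add_refl] adds the half-space bounded by the wall of r. *)
Definition conj_refl r G : set W := [set t ^ val r | t in G].
Definition add_refl r G : set W := G `|` [set val r].

Lemma faces_split J x G I n r :
  ncard (faces J x G I n) = (ncard (faces J x (add_refl r G) I n) +
    ncard (faces J x G I n `&` [set w | inversion w (val r)]))%N.
Proof.
rewrite (ncard_split [set w | inversion w (val r)]); last exact: finite_faces.
rewrite addnC; congr (ncard _ + _)%N; apply/seteqP; split=> w /=.
  case=> [[Jw mw Ix Gw sw]] /negP/negbTE nw; split=> // t [/Gw//|->//].
case=> Jw mw Ix Gw sw; split; last by rewrite Gw //; right.
by split=> // t Gt; apply: Gw; left.
Qed.

(** If r moves the face, only the length of the representative changes, by one. If r w = w a, the
    representative stays, on the side of 1, and y^w gets conjugated by a, which adds two by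
    [face_ascent]. *)
Lemma face_stat_conj y r I w (w' := face_step r I w) : y * y = 1 ->
    ~~ inversion y (val r) -> y ^ val r <> y -> min_rep I w ->
  (parabolic I ((y ^ val r) ^ w) <-> parabolic I (y ^ w')) /\
  (parabolic I (y ^ w') -> (face_stat (y ^ val r) w)%:Z =
     (if inversion w' (val r) then (face_stat y w')%:Z - 2%:Z
      else (face_stat y w')%:Z + 2%:Z)%R).
Proof.
rewrite {}/w' => yy nyr yr mw; case: (face_stepP r mw) => [mrw _|a Ia rw nwr].
  rewrite -conjgM; split=> // _; rewrite /face_stat -conjgM length_genMl //.
  rewrite (inversionM WS) (inversion_gen WS) eqxx conjgg.
  move: (len (_ ^ _)) => k.
  case: (boolP (inversion w (val r))) => /= [/inversion_length|_]; last by lia.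
  by case: (len w) => // n _; lia.
have E : (y ^ val r) ^ w = (y ^ w) ^ val a.
  by rewrite -!conjgM -rw conjgE mulVKg.
rewrite (negPf nwr) E; split.
  split=> [Iy|Iy]; last by apply: parabolicJ => //; apply: parabolic_gen.
  rewrite -(conjgK (val a) (y ^ w)) gen_inv //.
  by apply: parabolicJ => //; apply: parabolic_gen.
move=> Iy; rewrite /face_stat E involution_length_genJ; first by lia.
- exact: involutionJ.
- exact: face_ascent rw nwr Iy.
by rewrite -E => /conjg_inj.
Qed.

(** Translation by r matches the faces fixed by r y r with those fixed by y. Images on the side of 1
    of the wall of r have exponent n - 2, the others n + 2; the latter are counted as all faces
    minus those on the side of 1. *)
Lemma faces_conj J y r G I n : r \in J -> y * y = 1 ->
    ~~ inversion y (val r) -> y ^ val r <> y -> ~ G (val r) ->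
  (ncard (faces J (y ^ val r) G I n))%:Z =
    ((ncard (faces J y (add_refl r (conj_refl r G)) I (n - 2%:Z)))%:Z +
     (ncard (faces J y (conj_refl r G) I (n + 2%:Z)))%:Z -
     (ncard (faces J y (add_refl r (conj_refl r G)) I (n + 2%:Z)))%:Z)%R.
Proof.
move=> Jr yy nyr yr Gr; rewrite (faces_split J y (conj_refl r G) I (n + 2%:Z) r).
rewrite (ncard_split [set w | ~~ inversion (face_step r I w) (val r)]); last first.
  exact: finite_faces.
have tr t : G t -> t <> val r by move=> Gt tE; rewrite tE in Gt.
have Gstep w : min_rep I w -> (forall t, G t -> inversion w t = false) <->
    (forall t, conj_refl r G t -> inversion (face_step r I w) t = false).
  move=> mw; split=> [Gw _ [t Gt <-]|Gw t Gt].
    by rewrite face_step_inversion // ?Gw //; apply: tr.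
  by rewrite -(@face_step_inversion r _ _ _ mw (tr _ Gt)) Gw //; exists t.
have E1 : ncard (faces J (y ^ val r) G I n
             `&` [set w | ~~ inversion (face_step r I w) (val r)]) =
          ncard (faces J y (add_refl r (conj_refl r G)) I (n - 2%:Z)).
  apply: (@ncard_bij _ _ _ _ (face_step r I) (face_step r I)).
  - exact/finite_setIl/finite_faces.
  - move=> w [[Jw mw Ix Gw sw] /= nw]; split; last exact: face_stepK.
    have [IE sE] := face_stat_conj yy nyr yr mw.
    split; [exact: face_step_parabolic|exact: face_step_min|exact/IE| |].
      by move=> t [/(proj1 (Gstep w mw) Gw)//|->]; apply/negbTE.
    by move: sE; rewrite (negPf nw) => /(_ (proj1 IE Ix)) sE; lia.
  move=> w' [Jw mw Ix Gw sw]; have w'K := face_stepK r mw; split=> //.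
  have mw' := face_step_min r mw; have [IE sE] := face_stat_conj yy nyr yr mw'.
  rewrite w'K in IE sE; have nr : inversion w' (val r) = false by apply: Gw; right.
  split; last by rewrite /= w'K nr.
  split=> //; [exact: face_step_parabolic|exact/IE| |].
    by apply/Gstep => // t Gt; rewrite w'K Gw //; left.
  by move: (sE Ix); rewrite nr; lia.
have E2 : ncard (faces J (y ^ val r) G I n
             `&` ~` [set w | ~~ inversion (face_step r I w) (val r)]) =
          ncard (faces J y (conj_refl r G) I (n + 2%:Z)
             `&` [set w | inversion w (val r)]).
  apply: (@ncard_bij _ _ _ _ (face_step r I) (face_step r I)).
  - exact/finite_setIl/finite_faces.
  - move=> w [[Jw mw Ix Gw sw] /= /negP]; rewrite negbK => nw.
    split; last exact: face_stepK.
    have [IE sE] := face_stat_conj yy nyr yr mw; split=> //.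
    split; [exact: face_step_parabolic|exact: face_step_min|exact/IE| |].
      exact/Gstep.
    by move: sE; rewrite nw => /(_ (proj1 IE Ix)) sE; lia.
  move=> w' [[Jw mw Ix Gw sw] /= nr]; have w'K := face_stepK r mw; split=> //.
  have mw' := face_step_min r mw; have [IE sE] := face_stat_conj yy nyr yr mw'.
  rewrite w'K in IE sE; split; last by rewrite /= w'K nr.
  split=> //; [exact: face_step_parabolic|exact/IE| |].
    by apply/Gstep => // t Gt; rewrite w'K Gw.
  by move: (sE Ix); rewrite nr /=; lia.
rewrite E1 E2 !PoszD -addrA; congr (_ + _)%R.
by rewrite [X in (X - _)%R]addrC addrK.
Qed.

(** The faces fixed by r y are those fixed by both r and y, with exponent one higher than for y.
    They are counted as the faces of y on the side of 1 minus those that r moves; r carries the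
    latter to the faces of y on the far side, with exponent n + 1. *)
Lemma faces_mul J y r G I n : r \in J -> y * y = 1 ->
    ~~ inversion y (val r) -> y ^ val r = y -> ~ G (val r) ->
  (ncard (faces J (val r * y) G I n))%:Z =
    ((ncard (faces J y (add_refl r G) I (n - 1%:Z)))%:Z -
     (ncard (faces J y (conj_refl r G) I (n + 1%:Z)))%:Z +
     (ncard (faces J y (add_refl r (conj_refl r G)) I (n + 1%:Z)))%:Z)%R.
Proof.
move=> Jr yy nyr yr Gr; rewrite (faces_split J y (conj_refl r G) I (n + 1%:Z) r).
rewrite (ncard_split [set w | parabolic I (val r ^ w)]
  (finite_faces J y (add_refl r G) I (n - 1%:Z))).
have yJr w : y ^ (val r * w) = y ^ w by rewrite conjgM yr.
have tr t : G t -> t <> val r by move=> Gt tE; rewrite tE in Gt.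
have E1 : faces J y (add_refl r G) I (n - 1%:Z)
    `&` [set w | parabolic I (val r ^ w)] = faces J (val r * y) G I n.
  have statE w : min_rep I w -> parabolic I (val r ^ w) -> parabolic I (y ^ w) ->
      ~~ inversion w (val r) /\ face_stat (val r * y) w = (face_stat y w).+1.
    move=> mw Ir Iy; have [_ []//|a Ia rw nwr] := face_stepP r mw.
    split=> //; rewrite /face_stat conjMg rw length_genMl //.
    by rewrite (negPf (face_ascent _ _ mw Ia rw _ _)) // addnS.
  apply/seteqP; split=> w /=.
    case=> [[Jw mw Iy Gw sw] Ir]; have [nwr sE] := statE _ mw Ir Iy.
    split=> //; first by rewrite conjMg; apply: parabolicM.
    - by move=> t Gt; apply: Gw; left.
    - by rewrite sE; lia.
  (* The wall of r is an inversion of r y, which commutes with r, so exactly one of w and r y w lies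
     beyond it. Both are in the coset w W_I, which the wall must therefore cut. *)
  case=> Jw mw Ix Gw sw; have Ir : parabolic I (val r ^ w).
    have rx : val r ^ (val r * y) = val r.
      by rewrite conjgM conjgg; apply/conjg_fixP; rewrite commg1_sym; apply/conjg_fixP.
    have := inversionM WS (val r * y) w (val r).
    rewrite rx (inversionM WS (val r) y) (inversion_gen WS) eqxx conjgg (negPf nyr) /=.
    have -> : val r * y * w = w * ((val r * y) ^ w) by rewrite conjgE mulVKg.
    rewrite (inversionM WS); case: (inversion w (val r)) => /=.
      by move/(canRL (addKb true)) => /= irw; apply: parabolic_inversion Ix irw.
    by move=> irw; apply: parabolic_inversion Ix irw.
  have Iy : parabolic I (y ^ w) by move: Ix; rewrite conjMg parabolicMl.
  have [nwr sE] := statE _ mw Ir Iy; split=> //; split=> //; last first.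
    by move: sw; rewrite sE; lia.
  by move=> t [/Gw//|->]; apply/negbTE.
have E2 : ncard (faces J y (add_refl r G) I (n - 1%:Z)
             `&` ~` [set w | parabolic I (val r ^ w)]) =
          ncard (faces J y (conj_refl r G) I (n + 1%:Z)
             `&` [set w | inversion w (val r)]).
  apply: (@ncard_bij _ _ _ _ (face_step r I) (face_step r I)).
  - exact/finite_setIl/finite_faces.
  - move=> w [[Jw mw Iy Gw sw] /= nIr]; split; last exact: face_stepK.
    have nwr : inversion w (val r) = false by apply: Gw; right.
    have Gs t : conj_refl r G t -> inversion (face_step r I w) t = false.
      by case=> u Gu <-; rewrite face_step_inversion ?Gw //; [left|exact: tr].
    have := face_step_min r mw; have := face_step_parabolic I Jr Jw.
    move: Gs; case: face_stepP => // [_ _ Gs Jrw mrw|a Ia ra]; last first.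
      by case: nIr; rewrite ra; apply: parabolic_gen.
    split; last by rewrite /= (inversionM WS) (inversion_gen WS) eqxx conjgg nwr.
    split=> //; first by rewrite yJr.
    by move: sw; rewrite /face_stat yJr length_genMl // nwr; lia.
  move=> w [[Jw mw Iy Gw sw] /= nwr]; have wK := face_stepK r mw; split=> //.
  have Gs t : G t -> inversion (face_step r I w) t = false.
    move=> Gt; rewrite -(@face_step_inversion r I) ?wK; last exact: tr.
      by apply: Gw; exists t.
    exact: face_step_min.
  have := face_step_min r mw; have := face_step_parabolic I Jr Jw.
  move: Gs wK; case: face_stepP => // [_ nIr Gs _ Jrw mrw|a _ _]; last by rewrite nwr.
  split; last by rewrite /= conjgM conjgg.
  split=> //; first by rewrite yJr.
    move=> t [/Gs//|->].
    by rewrite (inversionM WS) (inversion_gen WS) eqxx conjgg nwr.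
  move: sw; rewrite /face_stat yJr length_genMl // nwr.
  by move: (len (y ^ w)) (inversion_length nwr); case: (len w) => // k l _; lia.
by rewrite E1 E2 [X in (_ - Posz X)%R]addnC !PoszD opprD addrA addrK subrK.
Qed.

End Faces.

(** * Alternating sums over subsets *)

Section AlternatingSums.
Local Open Scope ring_scope.

Lemma sum_signed_subsets (R : comNzRingType) (T : finType) (K : {set T}) :
  \sum_(I : {set T} | I \subset K) (-1) ^+ #|I| = (K == finset.set0)%:R :> R.
Proof.
have [->|/finset.set0Pn[a Ka]] := eqVneq.
  rewrite (big_pred1 finset.set0) ?cards0 // => I; exact: finset.subset0.
rewrite (bigID (fun I : {set T} => a \in I)) /=.
rewrite (reindex_onto (fun I => a |: I)%SET (fun I => I :\ a)%SET) /=; last first.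
  by move=> I /andP[_ aI]; rewrite finset.setD1K.
rewrite -[X in _ + X]opprK -sumrN; apply/eqP; rewrite subr_eq0; apply/eqP.
apply: eq_big => [I|I /andP[_ /eqP aI]].
  rewrite finset.setU11 andbT finset.subUset finset.sub1set Ka /=; congr (_ && _).
  apply/eqP/idP => [<-|aI]; first by rewrite finset.setD11.
  by rewrite finset.setU1K.
by rewrite cardsU1 -aI finset.setD11 add1n exprS mulN1r.
Qed.

Lemma ncard_cond (T : choiceType) (A : set T) (P : pred T) : finite_set A ->
  ncard (A `&` [set w | P w]) = (\sum_(w <- fset_set A) P w)%N.
Proof.
move=> fA; rewrite ncardE; last exact: finite_setIl.
rewrite fsbig_mkcondr fsbig_finite //; apply: eq_bigr => w _.
by rewrite mem_setE; case: ifP => Pw; move: Pw; rewrite unfold_in /= => ->.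
Qed.

(** Summing over I first, w contributes the signed number of subsets of [J :&: D w], which vanishes
    unless that set is empty. *)
Lemma sum_signed_ncard (T : choiceType) (K : finType) (A : set T)
    (J : {set K}) (D : T -> {set K}) : finite_set A ->
  \sum_(I : {set K} | I \subset J)
     (-1) ^+ #|I| * (ncard (A `&` [set w | I \subset D w]))%:Z =
  (ncard (A `&` [set w | (J :&: D w)%SET == finset.set0]))%:Z.
Proof.
move=> fA; rewrite ncard_cond //.
rewrite (eq_bigr (fun I : {set K} =>
    \sum_(w <- fset_set A) (-1) ^+ #|I| * (I \subset D w)%:R)); last first.
  by move=> I _; rewrite ncard_cond // -mulr_sumr -natr_sum natz.
rewrite exchange_big -[RHS]natz natr_sum /=; apply: eq_bigr => w _.
rewrite -sum_signed_subsets big_mkcond [RHS]big_mkcond /=; apply: eq_bigr => I _.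
by rewrite finset.subsetI; case: ifP; case: (_ \subset D w); rewrite ?mulr1 ?mulr0.
Qed.

End AlternatingSums.

(** * Longest elements and alternating sums over fixed faces *)

Section SignedFaces.
Local Open Scope ring_scope.
Local Open Scope group_scope.
Variables (W : groupType) (S : {fset W}).
Hypothesis WS : coxeter_system S.
Implicit Types (u v w x y t : W) (a r : S) (I J : {set S}) (G : set W).

Local Notation len := (cox_length S).
Local Notation inversion := (@inversion W S).

(** Stated through right descents, since these are what the alternating sum singles out; maximality
    of the length follows from [longest_length]. *)
Definition longest J w :=
  parabolic J w /\ forall a, a \in J -> inversion w^-1 (val a).

Lemma longest_length J w v :
  longest J w -> parabolic J v -> (len (w * v) + len v)%N = len w.
Proof.
move=> [Jw dw]; rewrite -[len (w * v)]lengthV // -[len w]lengthV // invgM.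
move nE : (len v) => n; elim: n v nE => [|n IHn] v vn Jv.
  by rewrite (length0 WS vn) invg1 mul1g addn0.
have [|a Ja va] := parabolic_descent WS Jv.
  by move=> v1; rewrite v1 length1 in vn.
have IH : (len ((val a * v)^-1 * w^-1) + n)%N = len w^-1.
  apply: IHn; first by rewrite length_genMl // va vn.
  by apply: parabolicM => //; apply: parabolic_gen.
(* Put v' = a v. The wall of a is an inversion of w^-1 and not of v', so its conjugate by v' is an
   inversion of v'^-1 w^-1. Reflecting there gives v^-1 w^-1, which is thus strictly shorter; the
   triangle inequality bounds the drop. *)
move: (dw _ Ja); rewrite -{1}(mulVKg (val a * v) w^-1) (inversionM WS).
rewrite (inversionM WS (val a) v) (inversion_gen WS) eqxx conjgg va /= =>
  /inversion_length.
have -> : val a ^ (val a * v) * ((val a * v)^-1 * w^-1) = v^-1 * w^-1.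
  rewrite conjgM conjgg conjgE invgM gen_inv // -!mulgA; congr (_ * _).
  by rewrite (mulgA v) mulgV mul1g mulgA gen_sq // mul1g.
have := lengthM WS v (v^-1 * w^-1); rewrite mulVKg vn -IH.
move: (len (v^-1 * _)) (len (_ * w^-1)) => k l.
by lia.
Qed.

Lemma longest_inversion J w t :
  longest J w -> is_reflection S t -> parabolic J t -> inversion w t.
Proof.
move=> lw rt Jt; apply/andP; split; first exact/asboolP.
have -> : t * w = w * (t ^ w) by rewrite conjgE mulVKg.
have Jtw : parabolic J (t ^ w) by apply: parabolicJ => //; case: lw.
rewrite -(longest_length lw Jtw) -[X in (X < _)%N]addn0 ltn_add2l lt0n.
apply/eqP => /(length0 WS) /eqP; rewrite conjg_eq1 => /eqP t1.
by have := reflection_self WS rt; rewrite {1}t1 inversion1.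
Qed.

Lemma longest_uniq J w w' : longest J w -> longest J w' -> w' = w.
Proof.
move=> lw lw'; have [Jw _] := lw; have [Jw' _] := lw'.
have J1 : parabolic J (w^-1 * w') by apply: parabolicM => //; apply: parabolicV.
have J2 : parabolic J (w'^-1 * w) by apply: parabolicM => //; apply: parabolicV.
have := longest_length lw J1; have := longest_length lw' J2; rewrite !mulVKg => e2 e1.
have /length0 w1 : len (w^-1 * w') = 0%N by lia.
by rewrite -(mulVKg w w') w1 // mulg1.
Qed.

Lemma longest_finite J w : longest J w -> finite_set (parabolic J).
Proof.
move=> lw; apply: sub_finite_set (finite_length WS (len w)) => v Jv /=.
by rewrite -(longest_length lw Jv) leq_addl.
Qed.

Definition signed_faces J x G (n : int) : int :=
  (\sum_(I : {set S} | I \subset J) (-1) ^+ #|I| * (ncard (faces J x G I n))%:Z)%R.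

(** The identity fixes every face, and w is minimal in w W_I exactly when I consists of right
    ascents of w. The signs cancel unless w has no right ascent in J. *)
Lemma signed_faces1 J G n :
  signed_faces J 1 G n = (ncard [set w | [/\ longest J w,
    forall t, G t -> inversion w t = false & (2 * len w)%N%:Z = n]])%:Z.
Proof.
pose A := [set w | [/\ parabolic J w, forall t, G t -> inversion w t = false
                     & (2 * len w)%N%:Z = n]].
pose D w := [set a : S | ~~ inversion w^-1 (val a)]%SET.
have fA : finite_set A.
  apply: sub_finite_set (finite_length WS `|n|) => w [_ _ <-] /=.
  by rewrite mulSn leq_addr.
have faceE I : faces J 1 G I n = A `&` [set w | I \subset D w].
  apply/seteqP; split=> w /=.
    case=> Jw mw _ Gw; rewrite /face_stat conj1g length1 // addn0 => sw.
    split=> //; apply/fintype.subsetP => a Ia; rewrite inE.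
    by rewrite (min_rep_inversionV WS mw) //; apply: parabolic_gen.
  case=> [[Jw Gw sw]] /fintype.subsetP ID; rewrite /faces /=.
  rewrite /face_stat conj1g length1 // addn0; split=> //; last exact: parabolic1.
  apply/(min_rep_genP WS) => a /ID; rewrite inE; exact: negbTE.
rewrite /signed_faces; under eq_bigr do rewrite faceE.
rewrite sum_signed_ncard //; congr (Posz (ncard _)); apply/seteqP; split=> w /=.
  case=> [[Jw Gw sw]]; rewrite setI_eq0 disjoint_subset => /fintype.subsetP dw.
  by split=> //; split=> // a /dw; rewrite !inE negbK.
case=> [[Jw dw] Gw sw]; split=> //; rewrite setI_eq0 disjoint_subset.
by apply/fintype.subsetP => a /dw; rewrite !inE negbK.
Qed.

Lemma signed_faces_conj J y r G n : r \in J -> y * y = 1 ->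
    ~~ inversion y (val r) -> y ^ val r <> y -> ~ G (val r) ->
  signed_faces J (y ^ val r) G n =
    (signed_faces J y (add_refl r (conj_refl r G)) (n - 2%:Z) +
     signed_faces J y (conj_refl r G) (n + 2%:Z) -
     signed_faces J y (add_refl r (conj_refl r G)) (n + 2%:Z))%R.
Proof.
move=> Jr yy nyr yr Gr; rewrite /signed_faces -big_split -sumrB; apply:
  eq_bigr => I _ /=.
by rewrite faces_conj // mulrBr mulrDr.
Qed.

Lemma signed_faces_mul J y r G n : r \in J -> y * y = 1 ->
    ~~ inversion y (val r) -> y ^ val r = y -> ~ G (val r) ->
  signed_faces J (val r * y) G n =
    (signed_faces J y (add_refl r G) (n - 1%:Z) -
     signed_faces J y (conj_refl r G) (n + 1%:Z) +
     signed_faces J y (add_refl r (conj_refl r G)) (n + 1%:Z))%R.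
Proof.
move=> Jr yy nyr yr Gr; rewrite /signed_faces -sumrB -big_split; apply:
  eq_bigr => I _ /=.
by rewrite faces_mul // mulrDr mulrBr.
Qed.

Definition ascending J x G :=
  forall t, G t -> [/\ is_reflection S t, parabolic J t & inversion x t = false].

(* The induction has to carry half-spaces: the recursions for [G = set0] involve
   the sums cut by the wall of r, which must be known to vanish. *)
Theorem signed_facesE J x : parabolic J x -> x * x = 1 ->
  (forall G n, (exists t, G t) -> ascending J x G ->
     signed_faces J x G n = 0%R) /\
  (forall n, signed_faces J x set0 n =
     ((-1) ^+ len x * signed_faces J 1 set0 (n + (len x)%:Z))%R).
Proof.
have [k] := ubnP (len x); elim: k x => // k IHk x; rewrite ltnS => lexk Jx xx.
have [->|/eqP x1] := eqVneq x 1.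
  split=> [G n [t Gt] GP|n]; last by rewrite length1 // expr0 mul1r addr0.
  (* The longest element lies beyond every wall of W_J, hence in none of the half-spaces. *)
  rewrite signed_faces1 ncard0 // => w [lw Gw _].
  have [rt Jt _] := GP _ Gt.
  by have := longest_inversion lw rt Jt; rewrite Gw.
have [r Jr xr] := parabolic_descent WS Jx x1.
have Jvr := parabolic_gen WS Jr.
have conj_refl0 : conj_refl r set0 = set0 by rewrite /conj_refl image_set0.
have rfl := reflection_gen r.
have GPr G : ascending J x G -> ~ G (val r).
  by move=> GP /GP[_ _]; rewrite xr.
have xV := involution_inv xx.
have nxr t : inversion x t = false -> (t ^ x == val r) = false.
  move=> nxt; apply/negP => /eqP txr; move: xr.
  by rewrite -txr involution_inversion // nxt.
have nr t : inversion x t = false -> (t == val r) = false.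
  by move=> nxt; apply/negP => /eqP tr; move: xr; rewrite -tr nxt.
have rKr u : (u ^ val r) ^ val r = u by rewrite -conjgM gen_sq // conjg1.
have [xrx|/eqP xrx] := eqVneq (x ^ val r) x.
  pose y := val r * x.
  have xE : x = val r * y by rewrite /y mulgA gen_sq // mul1g.
  have yr : y ^ val r = y by rewrite /y conjMg conjgg xrx.
  have cxr : x * val r = val r * x by rewrite [LHS]conjgC xrx.
  have yy : y * y = 1 by rewrite {2}/y -cxr /y mulgA -(mulgA _ x x) xx mulg1 gen_sq.
  have nyr : ~~ inversion y (val r).
    by rewrite /y (inversionM WS) (inversion_gen WS) eqxx conjgg xr.
  have Jy : parabolic J y by apply: parabolicM.
  have lx : len x = (len y).+1 by rewrite {1}xE length_genMl // (negPf nyr).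
  have [|A0 AE] := IHk y _ Jy yy; first by rewrite -lx.
  (* The half-spaces of G and their translates by r contain y as well: neither t nor its conjugate
     by x is r, since r is a descent of x and t is not an inversion of x. *)
  have ny t : inversion x t = false -> inversion y t = false.
    move=> nxt; rewrite /y -cxr (inversionM WS) nxt (inversion_gen WS).
    by rewrite nxr.
  have nyc t : inversion x t = false -> inversion y (t ^ val r) = false.
    move=> nxt; rewrite /y (inversionM WS) (inversion_gen WS) rKr nxt addbF.
    apply/eqP => tr; move: (nr _ nxt).
    by rewrite -(rKr t) tr conjgg eqxx.
  have add0 G : ascending J y G -> forall n, signed_faces J y (add_refl r G) n = 0%R.
    move=> GP n; apply: A0; first by exists (val r); right.
    by move=> t [/GP//|->]; split=> //; apply/negbTE.
  have conjP G : ascending J x G -> ascending J y (conj_refl r G).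
    by move=> GP _ [t /GP[rt Jt nxt] <-]; split;
      [exact: reflectionJ|exact: parabolicJ|exact: nyc].
  split=> [G n Gex GP|n]; rewrite {1}xE signed_faces_mul //.
  (* Each of the three sums is cut by at least one half-space containing 1 and y, so it vanishes by
     induction. *)
  - rewrite !add0 ?A0 ?subr0 ?addr0 //; [|exact: conjP..|].
      by case: Gex => t Gt; exists (t ^ val r), t.
    by move=> t /GP[rt Jt /ny].
  - exact: GPr.
  (* With G empty only the uncut sum for y survives, with a minus sign and a shift by one. *)
  rewrite conj_refl0 !add0 // AE sub0r addr0 lx exprS mulN1r mulNr.
  by congr (- (_ * signed_faces _ _ _ _))%R; lia.
pose y := x ^ val r.
have xE : x = y ^ val r by rewrite /y rKr.
have yr : y ^ val r <> y by rewrite -xE => xy; apply: xrx; rewrite -/y -xy.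
have yy : y * y = 1 by exact: involutionJ.
have yE : y = val r * (x * val r) by rewrite /y conjgE gen_inv.
have nyr : ~~ inversion y (val r).
  rewrite yE (inversionM WS) (inversion_gen WS) eqxx conjgg (inversionM WS) xr.
  rewrite (inversion_gen WS); apply/negP; rewrite /= negbK => /eqP => rx; apply: xrx.
  by apply/conjg_fixP; rewrite commg1_sym; apply/conjg_fixP.
have Jy : parabolic J y by apply: parabolicJ.
have lx : len x = (len y).+2 by rewrite xE involution_length_genJ.
have [|A0 AE] := IHk y _ Jy yy; first by apply: leq_trans lexk; rewrite lx.
have nyc t : inversion x t = false -> inversion y (t ^ val r) = false.
  move=> nxt; rewrite yE (inversionM WS) (inversion_gen WS) rKr.
  rewrite (inversionM WS) nxt (inversion_gen WS) nxr // !addbF.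
  apply/eqP => tr; move: (nr _ nxt).
  by rewrite -(rKr t) tr conjgg eqxx.
have add0 G : ascending J y G -> forall n, signed_faces J y (add_refl r G) n = 0%R.
  move=> GP n; apply: A0; first by exists (val r); right.
  by move=> t [/GP//|->]; split=> //; apply/negbTE.
have conjP G : ascending J x G -> ascending J y (conj_refl r G).
  by move=> GP _ [t /GP[rt Jt nxt] <-]; split;
    [exact: reflectionJ|exact: parabolicJ|exact: nyc].
split=> [G n Gex GP|n]; rewrite {1}xE signed_faces_conj //.
- rewrite !add0 ?A0 ?subr0 ?addr0 //; [|exact: conjP..].
  by case: Gex => t Gt; exists (t ^ val r), t.
- exact: GPr.
(* Again only the uncut sum for y survives, now with a plus sign and a shift by two, in accordance
   with l(x) = l(y) + 2. *)
rewrite conj_refl0 !add0 // AE add0r subr0 lx !exprS !mulN1r opprK.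
by congr (_ * signed_faces _ _ _ _)%R; lia.
Qed.

End SignedFaces.

(** * Generating functions *)

Section GeneratingFunctions.
Local Open Scope ring_scope.

(** [genfun] for an arbitrary statistic, so that a product of two series has the same form, as a
    count of pairs. *)
Definition gf (T : choiceType) (A : set T) (g : T -> nat) : fps rat :=
  FPS (fun n => (ncard [set x | A x /\ g x = n])%:R).

Definition finite_fibers (T : choiceType) (A : set T) (g : T -> nat) :=
  forall n, finite_set [set x | A x /\ g x = n].

Lemma fpscoefM (f g : fps rat) n :
  fpscoef (f * g) n = \sum_(i < n.+1) fpscoef f i * fpscoef g (n - i).
Proof. by []. Qed.

Lemma fpscoef0 n : fpscoef (0 : fps rat) n = 0.
Proof. exact: coef0. Qed.

Lemma fpscoef_sign k (f : fps rat) n :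
  fpscoef ((-1) ^+ k * f) n = (-1) ^+ k * fpscoef f n.
Proof. by rewrite -!(signr_odd _ k); case: (odd k); rewrite ?mulN1r ?mul1r. Qed.

Lemma fpscoef_sum (I : Type) (r : seq I) (P : pred I) (F : I -> fps rat) n :
  fpscoef (\sum_(i <- r | P i) F i) n = \sum_(i <- r | P i) fpscoef (F i) n.
Proof. by apply: (big_morph (fun f => fpscoef f n)) => //; apply: fpscoef0. Qed.

Lemma ncard_fibers (T U : choiceType) (A : set T) (f : T -> U) (r : seq U) :
    uniq r -> finite_set A -> (forall x, A x -> f x \in r) ->
  ncard A = (\sum_(y <- r) ncard [set x | A x /\ f x = y])%N.
Proof.
elim: r A => [|y r IHr] A /=; first by rewrite big_nil => _ _ A0; apply:
  ncard0 => p /A0.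
case/andP=> yr ur fA Ar; rewrite big_cons (ncard_split [set x | f x = y]) //.
congr (_ + _)%N; rewrite (IHr _ ur); first last.
- by move=> x [/Ar]; rewrite inE => /orP[/eqP|].
- exact: finite_setIl.
rewrite big_seq [RHS]big_seq; apply: eq_bigr => z zr; congr ncard.
apply/seteqP; split=> x /=; first by case=> [[]].
by case=> Ax fz; split=> //; split=> // fy; rewrite -fy fz zr in yr.
Qed.

Lemma ncardX (T U : choiceType) (A : set T) (B : set U) :
  finite_set A -> finite_set B -> ncard (A `*` B) = (ncard A * ncard B)%N.
Proof.
move=> fA fB; rewrite (@ncard_fibers _ _ _ fst (fset_set A)); first last.
- by move=> p [Ap _]; rewrite in_fset_set //; apply: mem_set.
- exact: finite_setX.
- exact: fset_uniq.
rewrite big_seq (eq_bigr (fun=> ncard B)) => [|x]; first last.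
  rewrite in_fset_set // => /set_mem Ax.
  apply: (@ncard_bij _ _ _ _ snd (pair x)).
  - by apply: sub_finite_set (finite_setX fA fB) => -[a b] [].
  - by move=> [a b] [[_ Bb] /= <-].
  - by move=> b Bb.
by rewrite -big_seq big_const_seq count_predT iter_addn_0 mulnC.
Qed.

Lemma finite_product_fibers (T U : choiceType) (A : set T) (B : set U) g h :
  finite_fibers A g -> finite_fibers B h ->
  finite_fibers (A `*` B) (fun p => g p.1 + h p.2)%N.
Proof.
move=> fA fB n.
have : finite_set (\bigcup_(i in `I_n.+1)
    ([set x | A x /\ g x = i] `*` [set x | B x /\ h x = (n - i)%N])).
  by apply: bigcup_finite => // i _; apply: finite_setX.
apply: sub_finite_set => -[a b] /= [[Aa Bb] <-]; exists (g a).
  by rewrite /= ltnS leq_addr.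
by split=> //=; rewrite addKn.
Qed.

Lemma gf_mul (T U : choiceType) (A : set T) (B : set U) g h :
  finite_fibers A g -> finite_fibers B h ->
  gf A g * gf B h = gf (A `*` B) (fun p => g p.1 + h p.2)%N.
Proof.
move=> fA fB; apply: fpsP => n; rewrite fpscoefM /=.
rewrite (@ncard_fibers _ _ _ (fun p => g p.1) (index_iota 0 n.+1)).
- rewrite big_mkord natr_sum; apply: eq_bigr => i _; rewrite -natrM -ncardX //.
  congr (ncard _)%:R; apply/seteqP; split=> -[a b] /=.
    by case=> [[Aa gi] [Bb ->]]; split=> //; rewrite gi subnKC // -ltnS.
  by case=> [[[Aa Bb] gh] gi]; split=> //; split=> //; rewrite -gi -[n in RHS]gh addKn.
- exact: iota_uniq.
- exact: finite_product_fibers.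
by move=> p [_ <-]; rewrite mem_index_iota ltnS leq_addr.
Qed.

Lemma gf_bij (T U : choiceType) (A : set T) (B : set U) g h
    (f : T -> U) (f' : U -> T) : finite_fibers A g ->
    (forall x, A x -> [/\ B (f x), f' (f x) = x & h (f x) = g x]) ->
    (forall y, B y -> A (f' y) /\ f (f' y) = y) ->
  gf A g = gf B h.
Proof.
move=> fA AB BA; apply: fpsP => n /=; congr (_%:R); apply: (@ncard_bij _ _ _ _ f f').
- exact: fA.
- by move=> x [/AB[Bx xK hx] <-].
move=> y [/BA[Ay yK] hy]; split=> //; split=> //.
by have [_ _] := AB _ Ay; rewrite yK => <-.
Qed.

End GeneratingFunctions.

(** * The series of fixed faces and their alternating sums *)

Section FaceSeries.
Local Open Scope ring_scope.
Variables (W : groupType) (S : {fset W}).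
Hypothesis WS : coxeter_system S.
Implicit Types (u v w x y t : W) (a r : S) (I J : {set S}).

Local Notation len := (cox_length S).

Definition reps J I : set W := [set w | parabolic J w /\ min_rep I w].

Lemma genfun_sqE (A : set W) : fps_sq (genfun S A) = gf A (fun w => 2 * len w)%N.
Proof.
apply: fpsP => n /=; case: ifP => n2.
  by rewrite ncard0 // => w [_ wn]; rewrite -wn mul2n odd_double in n2.
congr (_%:R); congr ncard; apply/seteqP; split=> w /= [Aw wn]; split=> //.
  by rewrite wn mul2n -[RHS]odd_double_half n2.
by rewrite -wn mul2n doubleK.
Qed.

Lemma finite_len2 (A : set W) : finite_fibers A (fun w => 2 * len w)%N.
Proof.
move=> n; apply: sub_finite_set (finite_length WS n) => w /= [_ <-].
by rewrite mulSn leq_addr.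
Qed.

(** The factorisation of w is (w h(w), h(w)^-1), where h(w) in W_I carries w to the minimal element
    of its coset; the lengths add by [min_rep_lengthD]. *)
Lemma parabolic_factor I J : I \subset J ->
  fps_sq (genfun S (parabolic J)) =
  fps_sq (genfun S (reps J I)) * fps_sq (genfun S (parabolic I)).
Proof.
move=> IJ; rewrite !genfun_sqE gf_mul; try exact: finite_len2.
have /choice[h hP] w : exists u, parabolic I u /\ min_rep I (w * u)%g.
  by have [u Iu mu] := min_rep_exists WS I w; exists u.
apply: (@gf_bij _ _ _ _ _ _ (fun w => (w * h w, (h w)^-1))%g
   (fun p => p.1 * p.2)%g (finite_len2 _)) => [w Jw|[w u] [[Jw mw] Iu]] /=.
  have [Ih mh] := hP w; have IhV := parabolicV WS Ih.
  split=> /=; last 2 first.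
  - by rewrite mulgK.
  - by rewrite -mulnDr -(min_rep_lengthD WS mh) // mulgK.
  by split=> //; split=> //; apply: parabolicM => //; apply: parabolicS IJ Ih.
split; first by apply: parabolicM => //; apply: parabolicS IJ Iu.
have [Ih mh] := hP (w * u)%g; rewrite -mulgA in mh.
have := min_rep_uniq WS mw _ mh => /(_ (parabolicM WS Iu Ih)) uh.
by rewrite -mulgA uh mulg1 -(mulg1_eq uh) invgK.
Qed.

Lemma genfunE (A : set W) : genfun S A = gf A len.
Proof. by []. Qed.

Lemma finite_bounded_length (A : set W) n :
  finite_set (A `&` [set w | (len w <= n)%N]).
Proof. by apply: finite_setIr; apply: finite_length. Qed.

(** Covers at once the involutions, the reflections and {1}. Closure under conjugation permits
    replacing z by w z w^-1. *)
Definition conj_involutions (K : set W) : Prop :=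
  (forall w, K w -> (w * w = 1)%g) /\ (forall w u, K w -> K (w ^ u)%g).

(** The pairs (z, w) are grouped by x = w z w^-1. Since l(x) is at most l(z) + 2 l(w) = n, the
    length bound loses nothing and keeps the sum over x finite. *)
Lemma face_series_coef (K : set W) I J n : conj_involutions K -> I \subset J ->
  fpscoef (genfun S (K `&` parabolic I) * fps_sq (genfun S (reps J I))) n =
  (\sum_(x <- fset_set (K `&` parabolic J `&` [set w | (len w <= n)%N]))
     ncard (faces J x set0 I n%:Z))%:R.
Proof.
move=> [_ KJ] IJ; have fl := finite_bounded_length.
have fib : finite_fibers ((K `&` parabolic I) `*` reps J I)
    (fun p => len p.1 + 2 * len p.2)%N.
  exact: (finite_product_fibers (finite_level WS _) (@finite_len2 _)).
rewrite genfun_sqE genfunE gf_mul; [|exact: finite_level WS _|exact: finite_len2].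
rewrite /= (@ncard_fibers _ _ _ (fun p => p.1 ^ p.2^-1)%g (fset_set
  (K `&` parabolic J `&` [set w | (len w <= n)%N]))); first last.
- move=> [z w] [[[Kz Iz] [Jw mw]] /= <-]; rewrite in_fset_set //; apply/mem_set.
  split=> /=; last first.
    rewrite conjgE invgK; apply: leq_trans (lengthM WS _ _) _.
    apply: leq_trans (leq_add (leqnn _) (lengthM WS _ _)) _.
    by rewrite lengthV // addnCA mul2n addnn.
  split; first exact: KJ.
  apply: parabolicJ => //; first exact: parabolicS IJ Iz.
  exact: parabolicV.
- exact: fib.
- exact: fset_uniq.
congr (_%:R); rewrite big_seq [RHS]big_seq; apply: eq_bigr => x.
rewrite in_fset_set // => /set_mem[[Kx Jx] _].
apply: (@ncard_bij _ _ _ _ snd (fun w => (x ^ w, w)%g)).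
- by apply: sub_finite_set (fib n) => p [].
- move=> [z w] [[[[Kz Iz] [Jw mw]] /= sE] <-]; rewrite conjgKV; split=> //.
  by split; rewrite ?conjgKV // /face_stat conjgKV -sE addnC.
move=> w [Jw mw Ix _ [sE]]; split=> //; split; last by rewrite /= conjgK.
by split=> /=; [split=> //; split=> //; apply: KJ|rewrite -sE addnC].
Qed.

Lemma alternating_series_coef (K : set W) J n : conj_involutions K ->
  fpscoef (\sum_(I : {set S} | I \subset J) (-1) ^+ #|I| *
     (genfun S (K `&` parabolic I) * fps_sq (genfun S (reps J I)))) n =
  (\sum_(x \in K `&` parabolic J `&` [set w | (len w <= n)%N])
     (-1) ^+ len x * signed_faces J 1%g set0 (n%:Z + (len x)%:Z))%:~R.
Proof.
move=> KP; have [KK _] := KP; have fl := finite_bounded_length.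
rewrite fsbig_finite // big_seq.
rewrite (eq_bigr (fun x => signed_faces J x set0 n)); last first.
  move=> x; rewrite in_fset_set // => /set_mem[[Kx Jx] _].
  by have [_ ->] := signed_facesE WS Jx (KK _ Kx).
rewrite -big_seq exchange_big rmorph_sum fpscoef_sum; apply: eq_bigr => I IJ.
rewrite fpscoef_sign face_series_coef // natr_sum mulr_sumr rmorph_sum.
by apply: eq_bigr => x _; rewrite rmorphM rmorphXn rmorphN1.
Qed.

Lemma signed_faces1_longest J w0 n : longest J w0 ->
  signed_faces J 1%g set0 n = (n == (2 * len w0)%N%:Z)%:R.
Proof.
move=> lw; rewrite signed_faces1 //; case: eqP => [->|nE].
  rewrite (@ncard1 _ _ w0) // => w; split=> [[lw' _ _]|->//].
  exact: longest_uniq lw lw'.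
by rewrite ncard0 // => w [lw' _]; rewrite (longest_uniq WS lw lw') => /esym.
Qed.

(** Multiplying by W_J(q^2) turns 1 / W_I(q^2) into the series of [reps J I]. Every x then
    contributes zero, because a longest element would make W_J finite. *)
Theorem alternating_series_infinite (K : set W) J :
    conj_involutions K -> infinite_set (parabolic J) ->
  \sum_(I : {set S} | I \subset J) (-1) ^+ #|I| *
     (genfun S (K `&` parabolic I) / fps_sq (genfun S (parabolic I))) = 0.
Proof.
move=> KP infJ; have UJ := genfun_parabolic_unit WS J.
apply: (mulIr UJ); rewrite mul0r mulr_suml.
transitivity (\sum_(I : {set S} | I \subset J) (-1) ^+ #|I| *
     (genfun S (K `&` parabolic I) * fps_sq (genfun S (reps J I)))).
  apply: eq_bigr => I IJ; rewrite (parabolic_factor IJ) -!mulrA.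
  by rewrite (mulrCA _^-1) mulVr ?mulr1 //; apply: genfun_parabolic_unit.
apply: fpsP => n; rewrite alternating_series_coef // fpscoef0 fsbig1 // => x _.
rewrite signed_faces1 // ncard0 ?mulr0 // => w [lw _ _].
by apply: infJ; apply: longest_finite lw.
Qed.

Theorem alternating_series_finite (K : set W) J w0 :
    conj_involutions K -> longest J w0 ->
  \sum_(I : {set S} | I \subset J) (-1) ^+ #|I| *
     (genfun S (K `&` parabolic I) * fps_sq (genfun S (reps J I))) =
  fps_of_poly (\sum_(x \in K `&` parabolic J)
     (-1) ^+ len x * ('X : {poly rat}) ^+ (2 * len w0 - len x)).
Proof.
move=> KP lw0; apply: fpsP => n; rewrite alternating_series_coef //.
have fJ : finite_set (K `&` parabolic J).
  by apply: finite_setIr; apply: longest_finite lw0.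
rewrite fsbig_mkcondr !fsbig_finite //= coef_sum rmorph_sum /=.
rewrite big_seq [RHS]big_seq; apply: eq_bigr => x.
rewrite in_fset_set // => /set_mem[Kx Jx].
have lx : (len x <= len w0)%N by rewrite -(longest_length WS lw0 Jx) leq_addl.
rewrite (signed_faces1_longest _ lw0) mem_setE.
have -> : (n%:Z + (len x)%:Z == (2 * len w0)%N%:Z) = (n == 2 * len w0 - len x)%N.
  by apply/eqP/eqP; lia.
have -> : ((-1) ^+ len x * 'X^(2 * len w0 - len x))`_n =
    (-1) ^+ len x * (n == 2 * len w0 - len x)%N%:R :> rat.
  by rewrite -!(signr_odd _ (len x)) -coefXn; case: (odd _);
    rewrite ?mul1r // !mulN1r coefN.
rewrite /in_mem /=; case: ifP => lxn.
  by rewrite rmorphM rmorphXn rmorphN1; case: (_ == _).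
(* The bound l(x) <= n discards no nonzero term: with N = l(w0), n = 2N - l(x) and l(x) <= N give
   l(x) <= n. *)
by case: eqP => [nE|_]; rewrite ?mulr0 //; move: lxn; rewrite nE; lia.
Qed.

End FaceSeries.

(** * Rational power series *)

Section Rationality.
Local Open Scope ring_scope.

Fact fps_of_poly_is_zmod_morphism : zmod_morphism (@fps_of_poly rat).
Proof. by move=> p r; apply: fpsP => n /=; rewrite coefB. Qed.

Fact fps_of_poly_is_monoid_morphism : monoid_morphism (@fps_of_poly rat).
Proof. by split=> // p r; apply: fpsP => n; rewrite fpscoefM /= coefM. Qed.

HB.instance Definition _ := GRing.isZmodMorphism.Build {poly rat} (fps rat)
  (@fps_of_poly rat) fps_of_poly_is_zmod_morphism.
HB.instance Definition _ := GRing.isMonoidMorphism.Build {poly rat} (fps rat)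
  (@fps_of_poly rat) fps_of_poly_is_monoid_morphism.

Implicit Types f g : fps rat.

Lemma fps_of_poly_inj : injective (@fps_of_poly rat).
Proof. by move=> p r pr; apply/polyP => n; by move/(congr1 (fun f :
  fps rat => fpscoef f n)): pr. Qed.

Lemma rational_poly (p : {poly rat}) : fps_rational (fps_of_poly p).
Proof. by exists p, 1; rewrite rmorph1 unitr1 divr1. Qed.

Lemma rationalD f g : fps_rational f -> fps_rational g -> fps_rational (f + g).
Proof.
move=> [a [b [Ub ->]]] [c [d [Ud ->]]]; exists (a * d + c * b), (b * d).
rewrite rmorphD !rmorphM unitrM Ub; split=> //.
apply: (canRL (mulrK _)); first by rewrite unitrM Ub.
by rewrite mulrDl mulrA divrK // mulrCA divrK // [X in _ + X]mulrC.
Qed.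

Lemma rationalM f g : fps_rational f -> fps_rational g -> fps_rational (f * g).
Proof.
move=> [a [b [Ub ->]]] [c [d [Ud ->]]]; exists (a * c), (b * d).
by rewrite !rmorphM unitrM Ub; split=> //; rewrite invrM // mulrACA [X in _ * X]mulrC.
Qed.

Lemma rational_sign k f : fps_rational f -> fps_rational ((-1) ^+ k * f).
Proof.
move=> rf; apply: rationalM => //.
by rewrite -(rmorph1 (@fps_of_poly rat)) -rmorphN -rmorphXn; apply: rational_poly.
Qed.

Lemma rationalV f : f \is a GRing.unit -> fps_rational f -> fps_rational f^-1.
Proof.
move=> Uf [a [b [Ub fE]]]; exists b, a.
have aE : fps_of_poly a = f * fps_of_poly b by rewrite fE divrK.
have Ua : fps_of_poly a \is a GRing.unit by rewrite aE unitrM Uf.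
by split=> //; rewrite aE invrM // mulrA divrr // mul1r.
Qed.

Lemma rational_sum (I : Type) (r : seq I) (P : pred I) (F : I -> fps rat) :
  (forall i, P i -> fps_rational (F i)) -> fps_rational (\sum_(i <- r | P i) F i).
Proof.
move=> rF; apply: big_ind => //; last exact: rationalD.
by rewrite -(rmorph0 (@fps_of_poly rat)); apply: rational_poly.
Qed.

Lemma fps_sq_poly (p : {poly rat}) : fps_sq (fps_of_poly p) = fps_of_poly (p \Po 'X^2).
Proof.
apply: fpsP => n /=; rewrite coef_comp_poly_Xn // dvdn2.
by case: (odd n) => //=; rewrite divn2.
Qed.

(** Multiplying by (-1)^|J| turns the sign of I into that of its complement in J. The subtraction in
    the exponent is never truncated, as I is proper. The term E serves the finite case; it is 0 in
    the infinite one. *)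
Lemma isolate_full (R : comNzRingType) (T : finType) (J : {set T})
    (F : {set T} -> R) (E : R) :
  \sum_(I : {set T} | I \subset J) (-1) ^+ #|I| * F I = E ->
  F J = (-1) ^+ #|J| * E +
    \sum_(I : {set T} | I \proper J) (-1) ^+ (#|(J :\: I)%SET| - 1)%N * F I.
Proof.
rewrite (bigD1 J) //= => <-.
rewrite mulrDr mulrA -exprMn mulrNN mulr1 expr1n mul1r -addrA -[LHS]addr0.
congr (_ + _); rewrite mulr_sumr; apply/esym/eqP; rewrite addr_eq0 -sumrN; apply/eqP.
apply: eq_big => [I|I /andP[IJ nIJ]]; first by rewrite finset.properEneq andbC.
have IJp : I \proper J by rewrite finset.properEneq nIJ.
have := cardsID I J; rewrite (finset.setIidPr IJ) => <-.
have := proper_card IJp; rewrite cardsD (finset.setIidPr IJ) => lt.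
rewrite mulrA -exprD addnAC addnn exprD -mul2n exprM sqrrN expr1n expr1n mul1r.
by move: lt; rewrite -subn_gt0; case: (_ - _)%N => // m _;
  rewrite subn1 exprS mulN1r mulNr.
Qed.

End Rationality.

(** * Rationality, and the finite case in the fraction field *)

Section CoxeterSeries.
Local Open Scope ring_scope.
Variables (W : groupType) (S : {fset W}).
Hypothesis WS : coxeter_system S.
Implicit Types (u v w x y t : W) (a r : S) (I J : {set S}) (K : set W).

Local Notation len := (cox_length S).
Local Notation full := (finset.setT : {set S}).

(** Induction on |J|: a finite W_J gives a polynomial, and for an infinite one the recurrence is
    solved for the term of J. *)
Lemma rational_parabolic_series K : conj_involutions K ->
    (forall J, fps_rational (fps_sq (genfun S (parabolic J)))) ->
  forall J, fps_rational (genfun S (K `&` parabolic J)).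
Proof.
move=> KP rat J; have [k] := ubnP #|J|; elim: k J => // k IHk J; rewrite ltnS => leJ.
have [fJ|infJ] := pselect (finite_set (parabolic J)).
  rewrite genfun_poly; first exact: rational_poly.
  exact: finite_setIr.
have := isolate_full (alternating_series_infinite WS KP infJ).
have UJ := genfun_parabolic_unit WS J.
rewrite mulr0 add0r => /(canRL (divrK UJ)) ->; apply: rationalM => //.
apply: rational_sum => I IJ; apply: rational_sign; apply: rationalM.
  by apply: IHk; apply: leq_trans leJ; apply: proper_card.
by apply: rationalV => //; apply: genfun_parabolic_unit.
Qed.

(** For the class {1} all numerators are 1, so the recurrence expresses 1 / W_J(q^2) through the
    proper subsets of J. *)
Lemma rational_parabolic J : fps_rational (fps_sq (genfun S (parabolic J))).
Proof.
have [k] := ubnP #|J|; elim: k J => // k IHk J; rewrite ltnS => leJ.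
have [fJ|infJ] := pselect (finite_set (parabolic J)).
  by rewrite genfun_poly // fps_sq_poly; apply: rational_poly.
have K1 : conj_involutions [set 1%g : W].
  by split=> [w ->|w u ->] /=; rewrite ?mulg1 ?conj1g.
have one I : genfun S ([set 1%g] `&` parabolic I) = 1.
  apply: fpsP => -[|n] /=; rewrite coef1 /=.
    rewrite (_ : [set w | _] = [set 1%g]) ?fset_set1 ?cardfs1 //.
    apply/seteqP; split=> [w [[]]|_ ->] //=.
    by rewrite length1 //; split=> //; split=> //; apply: parabolic1.
  rewrite (_ : [set w | _] = set0) ?fset_set0 //.
  by apply/seteqP; split=> // w [[-> _]]; rewrite length1.
have := isolate_full (alternating_series_infinite WS K1 infJ).
have UJ := genfun_parabolic_unit WS J.
rewrite one mul1r mulr0 add0r => EV; rewrite -[X in fps_rational X]invrK.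
apply: rationalV; first by rewrite unitrV.
rewrite EV; apply: rational_sum => I IJ; apply: rational_sign; rewrite one mul1r.
apply: rationalV; first exact: genfun_parabolic_unit.
by apply: IHk; apply: leq_trans leJ; apply: proper_card.
Qed.

Lemma genfun_at_rmorph (R R' : comNzRingType) (f : {rmorphism R -> R'})
    (A : set W) (z : R) : finite_set A ->
  f (genfun_at S A z) = genfun_at S A (f z).
Proof.
move=> fA; rewrite /genfun_at !fsbig_finite // rmorph_sum.
by apply: eq_bigr => w _; rewrite rmorphXn.
Qed.

Lemma genfun_sq_poly (A : set W) : finite_set A ->
  fps_sq (genfun S A) = fps_of_poly (genfun_at S A ('X^2 : {poly rat})).
Proof.
move=> fA; rewrite genfun_poly // fps_sq_poly.
rewrite -[X in fps_of_poly X]/(comp_poly 'X^2 (genfun_at S A 'X)).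
by rewrite genfun_at_rmorph //= comp_polyX.
Qed.

(** Substituting -q^-1 requires q to be invertible, so the identity of series is pulled back to
    polynomials, by injectivity of [fps_of_poly], and then pushed to fractions. *)
Theorem alternating_fraction K (w0 : W) :
    conj_involutions K -> longest full w0 ->
    let q : {fraction {poly rat}} := FracField.tofrac ('X : {poly rat}) in
  \sum_(I : {set S} | I \subset full) (-1) ^+ #|I| *
    (genfun_at S (K `&` parabolic I) q / genfun_at S (parabolic I) (q ^+ 2)) =
  q ^+ (2 * len w0) * genfun_at S (K `&` parabolic full) (- q^-1) /
    genfun_at S (parabolic full) (q ^+ 2).
Proof.
move=> KP lw0 q; set J := full in lw0 *.
have fJ := longest_finite WS lw0.
have fI I : finite_set (parabolic I).
  by apply: sub_finite_set fJ => w; apply: parabolicS => //; apply: finset.subsetT.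
have fK I : finite_set (K `&` parabolic I) by apply: finite_setIr.
have fR I : finite_set (reps J I) by apply: sub_finite_set fJ => w [].
have toq (A : set W) : finite_set A ->
    FracField.tofrac (genfun_at S A ('X : {poly rat})) = genfun_at S A q.
  by move=> fA; rewrite genfun_at_rmorph.
have toq2 (A : set W) : finite_set A ->
    FracField.tofrac (genfun_at S A ('X^2 : {poly rat})) = genfun_at S A (q ^+ 2).
  by move=> fA; rewrite genfun_at_rmorph //= rmorphXn.
have nz I : genfun_at S (parabolic I) (q ^+ 2) != 0.
  rewrite -toq2 // tofrac_eq0; apply/eqP => P0.
  have := genfun_parabolic_unit WS I.
  by rewrite genfun_sq_poly // P0 rmorph0 unitr0.
have factor I : genfun_at S (parabolic J) (q ^+ 2) =
    genfun_at S (reps J I) (q ^+ 2) * genfun_at S (parabolic I) (q ^+ 2).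
  rewrite -!toq2 // -rmorphM; congr (FracField.tofrac _).
  apply: fps_of_poly_inj; rewrite rmorphM /= -!genfun_sq_poly //.
  by apply: parabolic_factor => //; apply: finset.subsetT.
apply: (canRL (mulfK (nz J))); rewrite mulr_suml.
have := alternating_series_finite WS KP lw0.
rewrite (eq_bigr (fun I => fps_of_poly ((-1) ^+ #|I| *
    (genfun_at S (K `&` parabolic I) 'X * genfun_at S (reps J I) 'X^2)))); last first.
  move=> I _; rewrite rmorphM rmorphXn rmorphN1 rmorphM /=.
  by rewrite -genfun_sq_poly // -genfun_poly.
rewrite -rmorph_sum => /fps_of_poly_inj /(congr1 (@FracField.tofrac _)).
rewrite rmorph_sum /= => E.
transitivity (\sum_(I : {set S} | I \subset J) (-1) ^+ #|I| *
   (genfun_at S (K `&` parabolic I) q * genfun_at S (reps J I) (q ^+ 2))).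
  apply: eq_bigr => I _; rewrite (factor I) -!mulrA; congr (_ * (_ * _)).
  by rewrite mulrCA mulVf // mulr1.
rewrite (eq_bigr (fun I => FracField.tofrac ((-1) ^+ #|I| *
    (genfun_at S (K `&` parabolic I) 'X * genfun_at S (reps J I) 'X^2)))); last first.
  by move=> I _; rewrite rmorphM rmorphXn rmorphN1 rmorphM /= toq // toq2.
(* Term by term, with N = l(w0), q^(2N) (-q^-1)^l(x) equals (-1)^l(x) q^(2N - l(x)), as l(x) <=
   N. *)
rewrite E /genfun_at !fsbig_finite // rmorph_sum mulr_sumr.
rewrite big_seq [RHS]big_seq; apply: eq_bigr => x.
rewrite in_fset_set // => /set_mem[_ Jx].
have lx : (len x <= len w0)%N by rewrite -(longest_length WS lw0 Jx) leq_addl.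
have q0 : q != 0 by rewrite tofrac_eq0 polyX_eq0.
rewrite rmorphM rmorphXn rmorphN1 rmorphXn /= -/q (exprNn q^-1) mulrCA; congr (_ * _).
by rewrite exprVn expfB_cond // ?(negPf q0) //; lia.
Qed.

Lemma parabolic_setT : parabolic full = [set: W].
Proof. by case: WS => m _ []. Qed.

(** A reflection t is an inversion of itself. If t has a word over I, the exchange condition
    exhibits it as a letter of that word conjugated by a prefix, hence as a reflection of W_I. *)
Lemma reflections_parabolic I :
  reflections I = reflections full `&` parabolic I.
Proof.
apply/seteqP; split=> [_ [w Iw [a Ia <-]]|t [[w _ [a _ tE]] It]].
  split; first by exists w; [rewrite parabolic_setT|exists a; rewrite /= ?inE].
  by rewrite -mulgA; apply: parabolicJ => //; apply: parabolic_gen.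
have rt : is_reflection S t by exists w, a; rewrite -tE -mulgA.
have [s Is sE] := (parabolicP WS I t).1 It.
have := reflection_self WS rt;
  rewrite -{1}sE => /(inversion_word WS)[s1 [b [s2 [E ->]]]].
move: Is; rewrite E all_cat /= => /and3P[I1 Ib _].
exists (word s1)^-1%g; last by exists b => //=; rewrite -mulgA.
by apply: parabolicV => //; apply/(parabolicP WS); exists s1.
Qed.

Lemma involutions_parabolic I :
  involutions I = involutions full `&` parabolic I.
Proof.
apply/seteqP; split=> [w [Iw ww]|w [[_ ww] Iw]] //.
by split=> //; split=> //; rewrite parabolic_setT.
Qed.

Lemma conj_involutions_reflections :
  conj_involutions (reflections full).
Proof.
split=> [_ [w _ [a _ <-]]|_ u [w _ [a _ <-]]].
  by rewrite -(mulgA w^-1 (val a) w)%g -conjgE -conjMg gen_sq // conj1g.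
exists (w * u)%g; first by rewrite parabolic_setT.
exists a; first by rewrite /= inE.
by rewrite -[LHS]mulgA -[in RHS](mulgA w^-1)%g; exact: conjgM.
Qed.

Lemma conj_involutions_involutions :
  conj_involutions (involutions full).
Proof.
by split=> [w []|w u [_ ww]] //; split; rewrite ?parabolic_setT // -conjXg ww conj1g.
Qed.

Lemma longest_max w0 :
  (forall w, (len w <= len w0)%N) -> longest full w0.
Proof.
move=> max; split=> [|a _]; first by rewrite parabolic_setT.
apply: contraT => nw; have := max (w0 * val a)%g.
by rewrite length_genMr // (negPf nw) ltnn.
Qed.

End CoxeterSeries.

(** * The recurrences for involutions and reflections *)

Local Open Scope ring_scope.

Theorem corollary6p2 (W : groupType) (S : {fset W}) (C : {set S} -> set W)
    (hWS : coxeter_system S)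
    (hC : C = @involutions W S \/ C = @reflections W S) :
  fps_rational (genfun S (C finset.setT)) /\
  (infinite_set [set: W] ->
     \sum_(I : {set S}) (-1) ^+ #|I| *
        (genfun S (C I) / fps_sq (genfun S (parabolic I))) = 0 /\
     genfun S (C finset.setT) / fps_sq (genfun S [set: W]) =
     \sum_(I : {set S} | I \proper finset.setT) (-1) ^+ (#|(~: I)%SET| - 1)%N *
        (genfun S (C I) / fps_sq (genfun S (parabolic I)))) /\
  (forall w0 : W, finite_set [set: W] ->
     (forall w : W, (cox_length S w <= cox_length S w0)%N) ->
     let N := cox_length S w0 in
     let q : {fraction {poly rat}} := FracField.tofrac ('X : {poly rat}) in
     (genfun_at S (C finset.setT) q +
       (-1) ^ (#|` S|%:Z - 1) * q ^+ (2 * N) *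
         genfun_at S (C finset.setT) (- q^-1)) /
       genfun_at S [set: W] (q ^+ 2) =
     \sum_(I : {set S} | I \proper finset.setT) (-1) ^+ (#|(~: I)%SET| - 1)%N *
        (genfun_at S (C I) q / genfun_at S (parabolic I) (q ^+ 2))).
Proof.
(* From here on the choice of the class matters only through these two facts. *)
have [KP CE] : conj_involutions (C finset.setT) /\
    forall I, C I = C finset.setT `&` parabolic I.
  case: hC => ->; split; [exact: conj_involutions_involutions
    |exact: involutions_parabolic|exact: conj_involutions_reflections
    |exact: reflections_parabolic].
have subT (R : nmodType) (F : {set S} -> R) :
    \sum_(I : {set S}) F I = \sum_(I : {set S} | I \subset finset.setT) F I.
  by apply: eq_bigl => I; rewrite finset.subsetT.
split; first by rewrite CE; apply: rational_parabolic_series => //; apply: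
  rational_parabolic.
split=> [infW|w0 _ max N q].
  have infT : infinite_set (parabolic (finset.setT :
    {set S})) by rewrite parabolic_setT.
  have E0 : \sum_(I : {set S} | I \subset finset.setT) (-1) ^+ #|I| *
      (genfun S (C I) / fps_sq (genfun S (parabolic I))) = 0.
    rewrite -[RHS](alternating_series_infinite hWS KP infT).
    by apply: eq_bigr => I _; rewrite [in LHS]CE.
  rewrite subT; split=> //.
  have := isolate_full E0; rewrite mulr0 add0r parabolic_setT // => ->.
  by apply: eq_bigr => I _; rewrite finset.setTD.
have E0 : \sum_(I : {set S} | I \subset finset.setT) (-1) ^+ #|I| *
      (genfun_at S (C I) q / genfun_at S (parabolic I) (q ^+ 2)) =
    q ^+ (2 * N) * genfun_at S (C finset.setT) (- q^-1) / genfun_at S [set: W] (q ^+ 2).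
  have := alternating_fraction hWS KP (longest_max hWS max).
  rewrite -CE parabolic_setT // => <-.
  by apply: eq_bigr => I _; rewrite [in LHS]CE.
have := isolate_full E0; rewrite parabolic_setT // finset.cardsT.
rewrite (eq_bigr (fun I : {set S} => (-1) ^+ (#|(~: I)%SET| - 1)%N *
        (genfun_at S (C I) q / genfun_at S (parabolic I) (q ^+ 2)))); last first.
  by move=> I _; rewrite finset.setTD.
(* Isolating I = S leaves a term with sign (-1)^|S|, which the correction with (-1)^(|S| - 1)
   cancels. That exponent is an integer, so S may be empty. *)
move=> E; rewrite mulrDl E addrAC -!mulrA -mulrDl -[RHS]add0r; congr (_ + _).
rewrite expfzDr ?oppr_eq0 ?oner_eq0 // -cardfE.
have -> : ((-1) ^ (- 1%:Z) : {fraction {poly rat}}) = -1.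
  by rewrite exprN1 invrN1.
by rewrite mulrN1 subrr mul0r.
Qed.
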